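(* Let $B\subset\mathbb{R}^2$ be a disk. For every integer $k\ge 1$, $B$ is not a solution of the maximization problem $$\sup\{P(\Omega)^2\mu_k(\Omega) : \Omega\subset\mathbb{R}^2 \text{ nonempty, bounded, open and convex}\},$$ i.e. $P(B)^2\mu_k(B)$ is strictly less than this supremum.
   Context: For a nonempty bounded open convex set $\Omega\subset\mathbb{R}^2$, $P(\Omega)$ denotes its perimeter (length of the boundary), and $0=\mu_0(\Omega)<\mu_1(\Omega)\le\mu_2(\Omega)\le\cdots$ denote the eigenvalues, counted with multiplicity, of the Neumann Laplacian on $\Omega$: $\mu$ is an eigenvalue if there is $0\ne u\in H^1(\Omega)$ with $\int_\Omega\nabla u\cdot\nabla\varphi=\mu\int_\Omega u\varphi$ for all $\varphi\in H^1(\Omega)$. *)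

(* Defs.v *)
From HB Require Import structures.
From mathcomp Require Import all_boot all_order all_algebra.
From mathcomp Require Import all_classical all_reals all_analysis.

Set Implicit Arguments.
Unset Strict Implicit.
Unset Printing Implicit Defensive.

Import Order.TTheory GRing.Theory Num.Theory.
Import numFieldNormedType.Exports.

Local Open Scope classical_set_scope.
Local Open Scope ring_scope.

Section Plane.
Variable R : realType.
Implicit Types (A Omega : set (R * R)) (u v phi : R * R -> R).

(* The library's norm on [R * R] is the sup norm: it gives the usual topology
   and bounded sets, but disks and diameters need the Euclidean distance. *)
Definition euclid_dist (p q : R * R) : R :=
  Num.sqrt ((p.1 - q.1) ^+ 2 + (p.2 - q.2) ^+ 2).

Definition disk (c : R * R) (r : R) : set (R * R) := [set z | euclid_dist c z < r].

(* The union with [set 0] gives the empty set diameter 0 instead of -oo. *)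
Definition euclid_diam A : \bar R :=
  ereal_sup ([set 0%E] `|` [set (euclid_dist pq.1 pq.2)%:E | pq in A `*` A]).

Definition hausdorff1_delta (delta : R) A : \bar R :=
  ereal_inf [set (\sum_(0 <= i <oo) euclid_diam (U i))%E |
    U in [set U : nat -> set (R * R) |
      A `<=` \bigcup_i U i /\ forall i, (euclid_diam (U i) <= delta%:E)%E]].

Definition hausdorff1 A : \bar R :=
  ereal_sup [set hausdorff1_delta delta A | delta in [set d : R | 0 < d]].

(* Length of the boundary: its one-dimensional Hausdorff measure. *)
Definition perimeter Omega : \bar R :=
  hausdorff1 (closure Omega `\` interior Omega).

(* [measurableTypeR R] is [R] with the sigma-algebra on which
   [lebesgue_measure] is declared, namely the Borel sets; square-integrable
   classes all have Borel representatives. *)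
Definition plane : measurableType _ :=
  (measurableTypeR R * measurableTypeR R)%type.

Definition lebesgue2 : {measure set plane -> \bar R} :=
  (@lebesgue_measure R \x @lebesgue_measure R)%E.

Definition dx1 phi : R * R -> R := 'D_((1, 0) : R * R) phi.
Definition dx2 phi : R * R -> R := 'D_((0, 1) : R * R) phi.

Fixpoint Cn (n : nat) phi : Prop :=
  match n with
  | 0 => continuous phi
  | m.+1 => [/\ forall z, derivable phi z ((1, 0) : R * R),
                forall z, derivable phi z ((0, 1) : R * R),
                Cn m (dx1 phi) & Cn m (dx2 phi)]
  end.

Definition test_function Omega phi : Prop :=
  let supp := closure [set z | phi z != 0] in
  [/\ forall n, Cn n phi, compact supp & supp `<=` Omega].

Definition square_integrable Omega u : Prop :=
  measurable_fun (Omega : set plane) (u : plane -> R) /\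
  lebesgue2.-integrable Omega (fun z => (u z ^+ 2)%:E).

(* [u] is in H^1(Omega) and its distributional gradient there is [(g1, g2)],
   which is unique up to a negligible set. *)
Definition H1_grad Omega u (g1 g2 : R * R -> R) : Prop :=
  [/\ square_integrable Omega u,
      square_integrable Omega g1,
      square_integrable Omega g2 &
      forall phi, test_function Omega phi ->
        \int[lebesgue2]_(z in Omega) (u z * dx1 phi z) =
          - (\int[lebesgue2]_(z in Omega) (g1 z * phi z)) /\
        \int[lebesgue2]_(z in Omega) (u z * dx2 phi z) =
          - (\int[lebesgue2]_(z in Omega) (g2 z * phi z))].

Definition neumann_eigenspace Omega (lam : R) u : Prop :=
  exists g1 g2, H1_grad Omega u g1 g2 /\
    forall phi h1 h2, H1_grad Omega phi h1 h2 ->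
      \int[lebesgue2]_(z in Omega) (g1 z * h1 z + g2 z * h2 z) =
        lam * (\int[lebesgue2]_(z in Omega) (u z * phi z)).

(* The eigenspace of [lam], as a space of functions modulo equality almost
   everywhere on [Omega], has dimension at least [m]. In particular [lam] is an
   eigenvalue iff this holds for [m = 1]. *)
Definition multiplicity_ge Omega (lam : R) (m : nat) : Prop :=
  exists u : 'I_m -> R * R -> R,
    (forall i, neumann_eigenspace Omega lam (u i)) /\
    forall c : 'I_m -> R,
      {ae lebesgue2, forall z, Omega z -> \sum_(i < m) c i * u i z = 0} ->
      forall i, c i = 0.

(* [mu_k], with [k] counted from 0: the least [t] such that at least [k + 1]
   eigenvalues, each repeated at most as often as its multiplicity, are at
   most [t]. *)
Definition neumann_eigenvalue Omega (k : nat) : \bar R :=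
  ereal_inf [set t%:E | t in [set t : R |
    exists l : 'I_k.+1 -> R,
      (forall i, l i <= t) /\
      forall lam, multiplicity_ge Omega lam #|[pred i | l i == lam]|]].

Definition admissible Omega : Prop :=
  [/\ Omega !=set0, bounded_set Omega, open Omega & convex_set Omega].

Definition objective (k : nat) Omega : \bar R :=
  (perimeter Omega ^+ 2 * neumann_eigenvalue Omega k)%E.

End Plane.

(* Main.v *)
From HB Require Import structures.
From mathcomp Require Import all_boot all_order all_algebra.
From mathcomp Require Import all_classical all_reals all_analysis.
From mathcomp Require Import measurable_realfun.
From mathcomp Require Import ring lra zify.
Require Import Defs.

(** The rectangle [R_k = (0, 1) x (0, 1 / k)] does better than any disk, and the number
    [4 pi^2 (k + 1)^2] lies between the two values.

    The perimeter of [R_k] is [2 (k + 1) / k]. The products [cos (p pi x) cos (q k pi y)] are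
    Neumann eigenfunctions of [R_k] with eigenvalues [(p^2 + k^2 q^2) pi^2]. They form a complete
    system ([cosines_complete]), so every eigenvalue is one of these numbers. Only the
    [k] of them with [q = 0] and [p < k] lie below [(k pi)^2], and each is simple. Hence
    [mu_k >= (k pi)^2] ([rect_eigenvalue_ge]) and the value of [R_k] is at least
    [4 pi^2 (k + 1)^2].

    A disk of radius [r] has perimeter at most [2 pi r], so [mu_k < (k + 1)^2 / r^2] is what has
    to be shown ([disk_eigenvalue_lt]). In polar coordinates [J_m (x rho / r) cos (m theta)] and
    [J_m (x rho / r) sin (m theta)] are eigenfunctions with eigenvalue [x^2 / r^2] whenever
    [J_m' x = 0]. The constant and these pairs for [1 <= m] and [2 m <= k + 1] are at least
    [k + 1] independent eigenfunctions. It remains to find a positive zero of [J_m'] with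
    [x^2 < 2 m (m + 1)], because [2 m (m + 1) <= (k + 1)^2] for these [m]. If there were none, then
    [J_m], [J_(m+1)] and [J_(m+2)] would all be positive up to [x^2 = 2 m (m + 1)], and
    there the recurrence between them makes [J_m'] negative ([bessel_neumann_zero]).

    The passage from these explicit functions to the weak eigenvalue problem is
    [neumann_eigenfunction]. A weak eigenfunction is tested against all of [H^1], whose elements
    are known only through their distributional gradient. For [phi] in [H^1] the field
    [grad v] is therefore multiplied by cutoffs [chi_n] of compact support before the gradient of
    [phi] is integrated by parts. The extra term [phi grad chi_n . grad v] tends to [0] by
    dominated convergence, since the normal component of [grad v] vanishes at the boundary to
    first order.

    Completeness of the cosine products rests on the fact that they span the polynomials in
    [cos (pi x)] and [cos (k pi y)]. An integrable function orthogonal to all of them is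
    orthogonal to the bounded limits of such polynomials, among which are the indicators of
    the quadrants [{x < s, y < t}] ([step_poly_cvg]); as quadrants generate the Borel sets,
    the function vanishes almost everywhere.

    The perimeters are Hausdorff measures. Short arcs cover the circle ([perimeter_disk_le]);
    for the rectangle, every fine cover of the boundary projects to a cover of each side, up to
    the neighbourhoods of the corners ([perimeter_rect_ge]). *)

Set Implicit Arguments.
Unset Strict Implicit.
Unset Printing Implicit Defensive.

Import Order.TTheory GRing.Theory Num.Theory.
Import numFieldNormedType.Exports.

Local Open Scope classical_set_scope.
Local Open Scope ring_scope.

(** * Partial derivatives and smooth functions on the plane *)

Section PlaneCalculus.
Variable R : realType.
Implicit Types (f g u v phi : R * R -> R) (z : R * R).

Local Notation e1 := ((1, 0) : R * R).
Local Notation e2 := ((0, 1) : R * R).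

(** Partial derivatives are one-variable derivatives along the slices of [f]; the chain rule
    and the fundamental theorem of calculus reach the plane through this equivalence. *)
Lemma is_derive_slice1 f x y d :
  is_derive (x, y) e1 f d <-> is_derive x 1 (fun t => f (t, y)) d.
Proof.
have E : (fun h : R => h^-1 *: ((f \o shift (x, y)) (h *: e1) - f (x, y))) =
         (fun h : R => h^-1 *: (((fun t => f (t, y)) \o shift x) (h *: 1) - f (x, y))).
  apply/funext => h /=; congr (_ *: (f _ - _)).
  by congr pair => /=; rewrite ?scaler0 ?add0r.
by split=> -[D D']; split;
  [move: D; rewrite /derivable E|move: D'; rewrite /derive E|
   rewrite /derivable E|rewrite /derive E].
Qed.

Lemma is_derive_slice2 f x y d :
  is_derive (x, y) e2 f d <-> is_derive y 1 (fun t => f (x, t)) d.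
Proof.
have E : (fun h : R => h^-1 *: ((f \o shift (x, y)) (h *: e2) - f (x, y))) =
         (fun h : R => h^-1 *: (((fun t => f (x, t)) \o shift y) (h *: 1) - f (x, y))).
  apply/funext => h /=; congr (_ *: (f _ - _)).
  by congr pair => /=; rewrite ?scaler0 ?add0r.
by split=> -[D D']; split;
  [move: D; rewrite /derivable E|move: D'; rewrite /derive E|
   rewrite /derivable E|rewrite /derive E].
Qed.

(** A relation rather than a pair of functions, so that it carries differentiability with it; it
    determines [dx1 f] and [dx2 f] by [gradient_dx]. *)
Definition gradient f g1 g2 :=
  forall z, is_derive z e1 f (g1 z) /\ is_derive z e2 f (g2 z).

Lemma gradient_dx f g1 g2 : gradient f g1 g2 -> dx1 f = g1 /\ dx2 f = g2.
Proof.
move=> fg; split; apply/funext => z; have [d1 d2] := fg z.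
- exact: (@derive_val _ _ _ _ _ _ _ d1).
- exact: (@derive_val _ _ _ _ _ _ _ d2).
Qed.

Lemma gradient_cst (c : R) : gradient (fun=> c) (fun=> 0) (fun=> 0).
Proof. by move=> z; split; exact: is_derive_cst. Qed.

Lemma gradient_fst : gradient fst (fun=> 1) (fun=> 0).
Proof.
move=> [x y]; split; [apply/is_derive_slice1|apply/is_derive_slice2];
  first [exact: is_derive_id|exact: is_derive_cst].
Qed.

Lemma gradient_snd : gradient snd (fun=> 0) (fun=> 1).
Proof.
move=> [x y]; split; [apply/is_derive_slice1|apply/is_derive_slice2];
  first [exact: is_derive_id|exact: is_derive_cst].
Qed.

Lemma gradientD f f1 f2 g g1 g2 : gradient f f1 f2 -> gradient g g1 g2 ->
  gradient (fun z => f z + g z) (fun z => f1 z + g1 z) (fun z => f2 z + g2 z).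
Proof.
by move=> df dg z; have [? ?] := df z; have [? ?] := dg z; split; exact: is_deriveD.
Qed.

Lemma gradientM f f1 f2 g g1 g2 : gradient f f1 f2 -> gradient g g1 g2 ->
  gradient (fun z => f z * g z) (fun z => f1 z * g z + f z * g1 z)
    (fun z => f2 z * g z + f z * g2 z).
Proof.
move=> df dg z; have [? ?] := df z; have [? ?] := dg z; split;
  by apply: is_derive_eq; rewrite addrC [in LHS]/GRing.scale/= mulrC.
Qed.

Lemma gradient_comp (h h' : R -> R) f f1 f2 :
  (forall x : R, is_derive x (1 : R) h (h' x)) -> gradient f f1 f2 ->
  gradient (fun z => h (f z)) (fun z => h' (f z) * f1 z) (fun z => h' (f z) * f2 z).
Proof.
move=> dh df [x y]; have [d1 d2] := df (x, y); split.
- apply/is_derive_slice1; move/is_derive_slice1 : d1 => d1.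
  exact: (@is_derive1_comp _ h (fun t => f (t, y)) x _ _ (dh _) d1).
- apply/is_derive_slice2; move/is_derive_slice2 : d2 => d2.
  exact: (@is_derive1_comp _ h (fun t => f (x, t)) y _ _ (dh _) d2).
Qed.

Lemma gradient_eq f f1 f2 g1 g2 : gradient f f1 f2 ->
  (forall z, f1 z = g1 z) -> (forall z, f2 z = g2 z) -> gradient f g1 g2.
Proof. by move=> df E1 E2 z; rewrite -E1 -E2. Qed.

Lemma gradient_linear (a : R) f g1 g2 : gradient f g1 g2 ->
  gradient (fun z => a * f z) (fun z => a * g1 z) (fun z => a * g2 z).
Proof.
move=> df; apply: gradient_eq (gradientM (gradient_cst a) df) _ _ => z;
  by rewrite mul0r add0r.
Qed.

Lemma gradient_opp f f1 f2 : gradient f f1 f2 ->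
  gradient (fun z => - f z) (fun z => - f1 z) (fun z => - f2 z).
Proof. by move=> df z; have [d1 d2] := df z; split; exact: is_deriveN. Qed.

(** [Cn n.+1] does not mention [Cn n]. In the product rule some factors are differentiated and
    others are not, so inductions over the order need all orders up to [n] at once. *)
Definition Cn_le n f := forall m, (m <= n)%N -> Cn m f.

Lemma Cn_leS n f : Cn_le n.+1 f <->
  continuous f /\ exists g1 g2, [/\ gradient f g1 g2, Cn_le n g1 & Cn_le n g2].
Proof.
split=> [Cf|[cf [g1 [g2 [/[dup] df /gradient_dx[E1 E2] Cg1 Cg2]]]]].
- split; first exact: (Cf 0%N).
  have [d1 d2 _ _] := Cf 1%N isT.
  exists (dx1 f), (dx2 f); split=> [z|m mn|m mn].
  + by split; apply/derivableP.
  + by have [] := Cf m.+1 mn.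
  + by have [] := Cf m.+1 mn.
- move=> [_|m mn]; first exact: cf.
  split; rewrite ?E1 ?E2; [| |exact: Cg1|exact: Cg2] => z.
  + by have [[]] := df z.
  + by have [_ []] := df z.
Qed.

Lemma Cn_leW n f : Cn_le n.+1 f -> Cn_le n f.
Proof. by move=> Cf m mn; apply: Cf; exact: leqW. Qed.

Lemma Cn_le_cst n (c : R) : Cn_le n (fun=> c).
Proof.
elim: n c => [|n IH] c; first by move=> [|//] _ z; exact: cst_continuous.
apply/Cn_leS; split; first by move=> z; exact: cst_continuous.
by exists (fun=> 0), (fun=> 0); split; [exact: gradient_cst|exact: IH|exact: IH].
Qed.

Lemma Cn_leD n f g : Cn_le n f -> Cn_le n g -> Cn_le n (fun z => f z + g z).
Proof.
elim: n f g => [|n IH] f g Cf Cg.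
  move=> [|//] _ z; apply: cvgD; [exact: (Cf 0%N)|exact: (Cg 0%N)].
move: Cf Cg => /Cn_leS[cf [f1 [f2 [df Cf1 Cf2]]]] /Cn_leS[cg [g1 [g2 [dg Cg1 Cg2]]]].
apply/Cn_leS; split; first by move=> z; apply: cvgD; [exact: cf|exact: cg].
exists (fun z => f1 z + g1 z), (fun z => f2 z + g2 z).
by split; [exact: gradientD|exact: IH|exact: IH].
Qed.

Lemma Cn_leM n f g : Cn_le n f -> Cn_le n g -> Cn_le n (fun z => f z * g z).
Proof.
elim: n f g => [|n IH] f g.
  move=> Cf Cg [|//] _ z; apply: cvgM; [exact: (Cf 0%N)|exact: (Cg 0%N)].
move=> /[dup] Cf /Cn_leS[cf [f1 [f2 [df Cf1 Cf2]]]].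
move=> /[dup] Cg /Cn_leS[cg [g1 [g2 [dg Cg1 Cg2]]]].
apply/Cn_leS; split; first by move=> z; apply: cvgM; [exact: cf|exact: cg].
exists (fun z => f1 z * g z + f z * g1 z), (fun z => f2 z * g z + f z * g2 z).
by split; [exact: gradientM| |]; apply: Cn_leD; apply: IH => //; exact: Cn_leW.
Qed.

Lemma is_derive_continuous (h h' : R -> R) :
  (forall x : R, is_derive x (1 : R) h (h' x)) -> continuous h.
Proof.
move=> dh x; apply: differentiable_continuous; apply/derivable1_diffP.
by have [] := dh x.
Qed.

(** The whole tower [h] of derivatives of the outer function is carried along, because the
    gradient of [h k (f z)] involves [h k.+1]. *)
Lemma Cn_le_comp n (h : nat -> R -> R) f k :
  (forall k (x : R), is_derive x (1 : R) (h k) (h k.+1 x)) -> Cn_le n f ->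
  Cn_le n (fun z => h k (f z)).
Proof.
move=> dh; elim: n k f => [|n IH] k f.
  move=> Cf [|//] _ z; apply: continuous_comp; first exact: (Cf 0%N).
  exact: is_derive_continuous.
move=> /[dup] Cf /Cn_leS[cf [f1 [f2 [df Cf1 Cf2]]]].
apply/Cn_leS; split.
  by move=> z; apply: continuous_comp; [exact: cf|exact: is_derive_continuous].
exists (fun z => h k.+1 (f z) * f1 z), (fun z => h k.+1 (f z) * f2 z).
by split; [exact: gradient_comp| |]; apply: Cn_leM => //; apply: IH; exact: Cn_leW.
Qed.

Definition smooth f := forall n, Cn n f.

Lemma smooth_Cn_le f : smooth f <-> forall n, Cn_le n f.
Proof. by split=> [Cf n m _|Cf n]; [exact: Cf|exact: (Cf n n)]. Qed.

Lemma smooth_cst (c : R) : smooth (fun=> c).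
Proof. by apply/smooth_Cn_le => n; exact: Cn_le_cst. Qed.

Lemma smooth_fst : smooth fst.
Proof.
apply/smooth_Cn_le => -[|n]; first by move=> [|//] _ z; exact: cvg_fst.
apply/Cn_leS; split; first by move=> z; exact: cvg_fst.
by exists (fun=> 1), (fun=> 0); split; [exact: gradient_fst|exact: Cn_le_cst|exact: Cn_le_cst].
Qed.

Lemma smooth_snd : smooth snd.
Proof.
apply/smooth_Cn_le => -[|n]; first by move=> [|//] _ z; exact: cvg_snd.
apply/Cn_leS; split; first by move=> z; exact: cvg_snd.
by exists (fun=> 0), (fun=> 1); split; [exact: gradient_snd|exact: Cn_le_cst|exact: Cn_le_cst].
Qed.

Lemma smoothD f g : smooth f -> smooth g -> smooth (fun z => f z + g z).
Proof. by rewrite !smooth_Cn_le => Cf Cg n; exact: Cn_leD. Qed.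

Lemma smoothM f g : smooth f -> smooth g -> smooth (fun z => f z * g z).
Proof. by rewrite !smooth_Cn_le => Cf Cg n; exact: Cn_leM. Qed.

Lemma smooth_opp f : smooth f -> smooth (fun z => - f z).
Proof.
move=> sf; rewrite (_ : (fun z => - f z) = (fun z => -1 * f z)).
  by apply: smoothM => //; exact: smooth_cst.
by apply/funext => z; rewrite mulN1r.
Qed.

Lemma smooth_comp (h : nat -> R -> R) f k :
  (forall k (x : R), is_derive x (1 : R) (h k) (h k.+1 x)) -> smooth f ->
  smooth (fun z => h k (f z)).
Proof. by move=> dh; rewrite !smooth_Cn_le => Cf n; exact: Cn_le_comp. Qed.

Lemma smooth_continuous f : smooth f -> continuous f.
Proof. by move=> /(_ 0%N). Qed.

Lemma smooth_dx1 f : smooth f -> smooth (dx1 f).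
Proof. by move=> Cf n; have [] := Cf n.+1. Qed.

Lemma smooth_dx2 f : smooth f -> smooth (dx2 f).
Proof. by move=> Cf n; have [] := Cf n.+1. Qed.

Lemma smooth_gradient f : smooth f -> gradient f (dx1 f) (dx2 f).
Proof. by move=> Cf z; have [d1 d2 _ _] := Cf 1%N; split; exact/derivableP. Qed.

(** The sigma-algebra of the plane is a product sigma-algebra. An open set belongs to it as the
    union of the rational squares that it contains. *)
Lemma open_measurable_plane (U : set (R * R)) :
  open U -> measurable (U : set (plane R)).
Proof.
move=> oU.
pose box (a b c : rat) : set (plane R) :=
  [set z | `|z.1 - ratr a| < ratr c /\ `|z.2 - ratr b| < ratr c].
have mbox a b c : measurable (box a b c).
  have -> : box a b c = `](ratr a - ratr c : R), (ratr a + ratr c)[%classic `*`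
                        `](ratr b - ratr c : R), (ratr b + ratr c)[%classic.
    by apply/seteqP; split=> -[x y] /=; rewrite /box/= !in_itv/= -!ltr_distlC
      !(distrC _ (ratr _)).
  by apply: measurableX; exact: measurable_itv.
pose F a b c : set (plane R) := if `[< box a b c `<=` U >] then box a b c else set0.
suff -> : U = \bigcup_a \bigcup_b \bigcup_c F a b c.
  apply: bigcupT_measurable_rat => a; apply: bigcupT_measurable_rat => b.
  apply: bigcupT_measurable_rat => c; rewrite /F; case: asboolP => // _.
apply/seteqP; split=> [[x y] Uxy|z]; last first.
  by move=> [a _ [b _ [c _]]]; rewrite /F; case: asboolP => // /[apply].
have [e/= e0 eU] : exists2 e : R, 0 < e & ball (x, y) e `<=` U.
  by apply/nbhs_ballP; exact: oU.
have e20 : 0 < e / 2 by rewrite divr_gt0.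
have [c] := rat_in_itvoo e20; rewrite in_itv/= => /andP[c0 ce].
have [a] := @rat_in_itvoo R (x - ratr c) (x + ratr c) ltac:(lra).
rewrite in_itv/= => /andP[a1 a2].
have [b] := @rat_in_itvoo R (y - ratr c) (y + ratr c) ltac:(lra).
rewrite in_itv/= => /andP[b1 b2].
have ax : `|x - ratr a| < ratr c.
  by rewrite ltr_norml; apply/andP; split; lra.
have bx : `|y - ratr b| < ratr c.
  by rewrite ltr_norml; apply/andP; split; lra.
exists a => //; exists b => //; exists c => //; rewrite /F asboolT//.
move=> [s t] [/= sa tb]; apply: eU; split => /=; rewrite /ball/=.
- rewrite (_ : x - s = (x - ratr a) - (s - ratr a)); last by lra.
  by rewrite (le_lt_trans (ler_normB _ _))//; lra.
- rewrite (_ : y - t = (y - ratr b) - (t - ratr b)); last by lra.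
  by rewrite (le_lt_trans (ler_normB _ _))//; lra.
Qed.

Lemma continuous_measurable_plane f (D : set (plane R)) :
  continuous f -> measurable_fun D (f : plane R -> R).
Proof.
move=> /continuousP cf; apply: measurable_funTS.
apply: (measurability _ (measurable_realfun.RGenOpens.measurableE R)).
move=> _ [_ [a [b ->] <-]]; rewrite setTI.
by apply: open_measurable_plane; exact/cf/interval_open.
Qed.

End PlaneCalculus.

(** * Bessel functions and the zeros of their derivatives *)

Section Bessel.
Variable R : realType.
Implicit Types (m n : nat) (t : R).

(** The Taylor coefficients of [m! (2 / x)^m J_m x] in the variable [t = x^2]. Thus
    [x^m * bessel m (x^2)] is [J_m x] up to a constant factor, [bessel m 0 = 1], and
    composing with a squared distance leaves a smooth function. *)
Definition bessel_coef m n : R :=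
  (-1) ^+ n * m`!%:R / (4 ^+ n * n`!%:R * (m + n)`!%:R).

Definition bessel m t : R := limn (pseries (bessel_coef m) t).

Let fact_neq0 n : n`!%:R != 0 :> R.
Proof. by rewrite pnatr_eq0 -lt0n fact_gt0. Qed.

(** Since [m! <= (m + n)!], the terms are dominated by those of the exponential series. *)
Lemma is_cvg_bessel m t : cvgn (pseries (bessel_coef m) t).
Proof.
apply: normed_cvg.
apply: (@series_le_cvg _ _ (fun n => exp_coeff `|t| n)) => [n|n|n|].
- by rewrite normr_ge0.
- by rewrite exp_coeff_ge0.
- rewrite /exp_coeff/= /bessel_coef normrM normrX mulrC ler_wpM2l ?exprn_ge0//.
  rewrite -mulrA normrM normrX normrN1 expr1n mul1r ger0_norm; last first.
    by rewrite divr_ge0// ?mulr_ge0// ?exprn_ge0.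
  rewrite ler_pdivrMr; last first.
    by rewrite !mulr_gt0 ?exprn_gt0 ?ltr0n ?fact_gt0.
  rewrite mulrA mulrCA mulVf// mulr1 -[leLHS]mul1r ler_pM//.
    by rewrite exprn_ege1// ler1n.
  by rewrite ler_nat leq_fact ?leq_addr.
- exact: is_cvg_series_exp_coeff.
Qed.

Lemma bessel_diffs m : pseries_diffs (bessel_coef m) =
  (fun n => - (4 * m.+1%:R)^-1 * bessel_coef m.+1 n).
Proof.
apply/funext => n; rewrite /pseries_diffs /bessel_coef addnS addSn !exprS !factS !natrM.
have n0 : n.+1%:R != 0 :> R by rewrite pnatr_eq0.
have m0 : m.+1%:R != 0 :> R by rewrite pnatr_eq0.
have mn0 : (m + n).+1%:R != 0 :> R by rewrite pnatr_eq0.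
have e0 : 4 ^+ n != 0 :> R by rewrite expf_neq0// pnatr_eq0.
have := fact_neq0 m; have := fact_neq0 n; have := fact_neq0 (m + n).
move: n0 m0 mn0 e0.
move: (n.+1%:R : R) (m.+1%:R : R) ((m + n).+1%:R : R) (4 ^+ n : R).
move: (m`!%:R : R) (n`!%:R : R) ((m + n)`!%:R : R) ((-1) ^+ n : R) => *.
by field; do ?(apply/andP; split).
Qed.

Lemma cvg_pseriesZ (k : R) (c : R^nat) t : cvgn (pseries c t) ->
  pseries (fun n => k * c n) t @ \oo --> k * limn (pseries c t).
Proof.
move=> cc; rewrite (_ : pseries _ _ = (fun n => k * pseries c t n)).
  exact: cvgMr.
apply/funext => n; rewrite /pseries /series/= mulr_sumr.
by apply: eq_bigr => i _; rewrite mulrA.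
Qed.

Lemma is_derive_bessel m t :
  is_derive t (1 : R) (bessel m) (- (4 * m.+1%:R)^-1 * bessel m.+1 t).
Proof.
have cZ (k : R) (d : R^nat) s : cvgn (pseries d s) -> cvgn (pseries (fun n => k * d n) s).
  by move=> dc; apply: cvgP; exact: cvg_pseriesZ dc.
have D k : pseries_diffs (fun n => k * bessel_coef m.+1 n) =
    (fun n => k * pseries_diffs (bessel_coef m.+1) n).
  by apply/funext => n; rewrite /pseries_diffs mulrCA.
have -> : - (4 * m.+1%:R)^-1 * bessel m.+1 t = limn (pseries (pseries_diffs (bessel_coef m)) t).
  rewrite bessel_diffs; apply/esym/cvg_lim => //.
  exact: cvg_pseriesZ (@is_cvg_bessel m.+1 t).
apply: (@pseries_snd_diffs _ _ (`|t| + 1)).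
- exact: is_cvg_bessel.
- by rewrite bessel_diffs; apply: cZ; exact: is_cvg_bessel.
- by rewrite bessel_diffs D bessel_diffs; apply: (cZ); apply: cZ; exact: is_cvg_bessel.
- by rewrite [ltRHS]ger0_norm ?addr_ge0// ltrDl.
Qed.

(** The recurrence [J_m x + J_(m+2) x = (2 (m + 1) / x) J_(m+1) x] in the normalization of
    [bessel]; it also encodes the Bessel differential equation, as [bessel m.+1] and [bessel m.+2]
    are the first two derivatives of [bessel m] up to constants. *)
Lemma bessel_contiguous m t :
  bessel m.+1 t = bessel m t + t / (4 * m.+1%:R * m.+2%:R) * bessel m.+2 t.
Proof.
suff : pseries (bessel_coef m.+1) t (n.+1)%N @[n --> \oo] -->
    bessel m t + t / (4 * m.+1%:R * m.+2%:R) * bessel m.+2 t.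
  by rewrite cvg_shiftS => /cvg_lim <-.
rewrite (_ : (fun n => _) = (fun n => pseries (bessel_coef m) t n.+1 +
    t / (4 * m.+1%:R * m.+2%:R) * pseries (bessel_coef m.+2) t n)).
  apply: cvgD; last by apply: cvgMr; exact: is_cvg_bessel.
  by rewrite cvg_shiftS; exact: is_cvg_bessel.
apply/funext => n; rewrite /pseries /series/= !big_nat_recl// !expr0.
rewrite mulr_sumr -addrA -big_split/=; congr (_ + _).
  by rewrite /bessel_coef !addn0 !expr0 !mul1r !mulr1 !divff.
apply: eq_bigr => i _; rewrite exprS /bessel_coef !addnS !addSn !exprS !factS !natrM.
have n0 : i.+1%:R != 0 :> R by rewrite pnatr_eq0.
have m1 : m.+1%:R != 0 :> R by rewrite pnatr_eq0.
have m2 : m.+2%:R != 0 :> R by rewrite pnatr_eq0.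
have mn1 : (m + i).+1%:R != 0 :> R by rewrite pnatr_eq0.
have mn2 : (m + i).+2%:R != 0 :> R by rewrite pnatr_eq0.
have E1 : (m + i).+2%:R = m.+1%:R + i.+1%:R :> R by rewrite -natrD addnS addSn.
have e0 : 4 ^+ i != 0 :> R by rewrite expf_neq0// pnatr_eq0.
have := fact_neq0 m; have := fact_neq0 i; have := fact_neq0 (m + i).
move: mn2; rewrite E1; move: n0 m1 m2 mn1 e0.
move: (i.+1%:R : R) (m.+1%:R : R) (m.+2%:R : R) ((m + i).+1%:R : R) (4 ^+ i : R) (t ^+ i).
move: (m`!%:R : R) (i`!%:R : R) ((m + i)`!%:R : R) ((-1) ^+ i : R) => *.
by field; do ?(apply/andP; split).
Qed.

Lemma bessel_at0 m : bessel m 0 = 1.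
Proof.
apply/cvg_lim => //; rewrite -cvg_shiftS.
rewrite (_ : (fun n => _) = (fun=> 1)); first exact: cvg_cst.
apply/funext => n; rewrite /pseries /series/= big_nat_recl// big1 ?addr0.
  by rewrite expr0 mulr1 /bessel_coef addn0 !expr0 !mul1r divff.
by move=> i _; rewrite exprS mul0r mulr0.
Qed.

Lemma bessel_continuous m : continuous (bessel m).
Proof. exact: is_derive_continuous (is_derive_bessel m). Qed.

(** The derivative of [x^m * bessel m (x^2)] is [x^(m-1) * bessel_neumann m (x^2)]; the positive
    zeros of [bessel_neumann m] are the squares of those of [J_m']. *)
Definition bessel_neumann m t : R :=
  m%:R * bessel m t - t / (2 * m.+1%:R) * bessel m.+1 t.

Lemma bessel_neumann_continuous m : continuous (bessel_neumann m).
Proof.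
move=> t; apply: cvgB; first by apply: cvgMr; exact: bessel_continuous.
apply: cvgM; last exact: bessel_continuous.
by apply: cvgMl; exact: cvg_id.
Qed.

Lemma is_derive_expn n (x : R) :
  is_derive x (1 : R) (fun s : R => s ^+ n.+1) (n.+1%:R * x ^+ n).
Proof.
rewrite (_ : (fun s => _) = (id : R -> R) ^+ n.+1); last first.
  by apply/funext => s; rewrite fctE.
by apply: is_derive_eq; rewrite /GRing.scale/= mulr1.
Qed.

Lemma is_derive1M (h k : R -> R) (x a b : R) :
  is_derive x (1 : R) h a -> is_derive x (1 : R) k b ->
  is_derive x (1 : R) (fun s => h s * k s) (a * k x + h x * b).
Proof.
move=> dh dk; apply: (@is_derive_eq _ _ _ (h * k)).
by rewrite addrC [in LHS]/GRing.scale/= [k x * a]mulrC.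
Qed.

Lemma gt0_of_derive (h h' : R -> R) (b : R) :
  (forall x : R, is_derive x (1 : R) h (h' x)) -> h 0 = 0 ->
  (forall x, 0 < x < b -> 0 < h' x) -> 0 < b -> 0 < h b.
Proof.
move=> dh h0 h'0 b0; have [x xb] := @MVT _ h h' _ _ b0 (fun x _ => dh x)
  (continuous_subspaceT (is_derive_continuous dh)).
rewrite h0 !subr0 => ->; rewrite mulr_gt0//.
by apply: h'0; rewrite in_itv/= in xb.
Qed.

(** The function [s^(m+1) * bessel m.+1 (s^2)] vanishes at [0] and has the derivative
    [s^m * bessel_neumann m.+1 (s^2)]. *)
Lemma bessel_gt0_of_neumann m (T : R) :
  (forall t, 0 < t < T -> 0 < bessel_neumann m.+1 t) ->
  forall t, 0 < t <= T -> 0 < bessel m.+1 t.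
Proof.
move=> g0 t /andP[t0 tT].
pose h s : R := s ^+ m.+1 * bessel m.+1 (s ^+ 2).
pose h' s := s ^+ m * bessel_neumann m.+1 (s ^+ 2).
have dh x : is_derive x (1 : R) h (h' x).
  have d1 : is_derive x (1 : R) (fun s : R => s ^+ m.+1) (m.+1%:R * x ^+ m).
    exact: is_derive_expn.
  have d2 : is_derive x (1 : R) (fun s : R => s ^+ 2) (2 * x).
    by have := is_derive_expn 1 x; rewrite expr1.
  have d3 := @is_derive1_comp _ _ (fun s : R => s ^+ 2) _ _ _
    (is_derive_bessel m.+1 (x ^+ 2)) d2.
  apply: (@is_derive_eq _ _ _ h _ _ _ _ (is_derive1M d1 d3)).
  rewrite /h' /bessel_neumann [(_ \o _) x]/= (exprS x m).
  have m2 : m.+2%:R != 0 :> R by rewrite pnatr_eq0.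
  move: m2; move: (m.+2%:R : R) (m.+1%:R : R) (x ^+ m) => *.
  by field.
have s0 : 0 < Num.sqrt t by rewrite sqrtr_gt0.
have s2 : Num.sqrt t ^+ 2 = t by rewrite sqr_sqrtr// ltW.
suff : 0 < h (Num.sqrt t) by rewrite /h s2 pmulr_rgt0// exprn_gt0.
apply: (gt0_of_derive dh) => //; first by rewrite /h expr0n mul0r.
move=> x /andP[x0 xs]; rewrite /h' mulr_gt0 ?exprn_gt0// g0// exprn_gt0//=.
by rewrite (lt_le_trans _ tT)// -s2 ltrXn2r// ltW.
Qed.

(** The function [s^(m+1) * bessel m.+1 s] vanishes at [0] and has the derivative
    [(m + 1) s^m * bessel m s]. *)
Lemma bessel_gt0S m (T : R) :
  (forall t, 0 < t < T -> 0 < bessel m t) ->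
  forall t, 0 < t <= T -> 0 < bessel m.+1 t.
Proof.
move=> f0 t /andP[t0 tT].
pose h s : R := s ^+ m.+1 * bessel m.+1 s.
pose h' s := m.+1%:R * s ^+ m * bessel m s.
have dh x : is_derive x (1 : R) h (h' x).
  have d1 : is_derive x (1 : R) (fun s : R => s ^+ m.+1) (m.+1%:R * x ^+ m).
    exact: is_derive_expn.
  apply: (@is_derive_eq _ _ _ h _ _ _ _ (is_derive1M d1 (is_derive_bessel m.+1 x))).
  rewrite /h' (exprS x m) bessel_contiguous.
  have m2 : m.+2%:R != 0 :> R by rewrite pnatr_eq0.
  have m1 : m.+1%:R != 0 :> R by rewrite pnatr_eq0.
  move: m1 m2; move: (m.+2%:R : R) (m.+1%:R : R) (x ^+ m) => *.
  by field; apply/andP.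
suff : 0 < h t by rewrite /h pmulr_rgt0// exprn_gt0.
apply: (gt0_of_derive dh) => //; first by rewrite /h expr0n mul0r.
move=> x /andP[x0 xs]; rewrite /h' !mulr_gt0 ?exprn_gt0// ?ltr0n// f0// x0/=.
exact: lt_le_trans xs tT.
Qed.

(** Otherwise [bessel_neumann m], which equals [m] at [0], would be positive up to
    [T = 2 m (m + 1)], and so would be [bessel m], [bessel m.+1] and [bessel m.+2]. At [T] the two
    coefficients of [bessel_neumann m] are opposite, so its value is
    [m (bessel m T - bessel m.+1 T)], which by [bessel_contiguous] is a negative multiple of
    [bessel m.+2 T]. *)
Lemma bessel_neumann_zero m : (0 < m)%N ->
  exists2 t, 0 < t < 2 * m%:R * m.+1%:R & bessel_neumann m t = 0.
Proof.
case: m => // m _; set T := 2 * m.+1%:R * m.+2%:R.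
have T0 : 0 < T by rewrite !mulr_gt0 ?ltr0n.
have g0 : 0 < bessel_neumann m.+1 0.
  by rewrite /bessel_neumann mul0r mul0r subr0 bessel_at0 mulr1 ltr0n.
apply: contrapT => nz.
have {nz} gN0 t : 0 < t < T -> bessel_neumann m.+1 t != 0.
  by move=> tT; apply/eqP => gt; apply: nz; exists t.
have ivt t : 0 < t <= T -> bessel_neumann m.+1 t <= 0 -> 
    exists2 s, 0 < s <= t & bessel_neumann m.+1 s = 0.
  move=> /andP[t0 tT] gt0.
  have [|||s] := @IVT _ (bessel_neumann m.+1) 0 t 0.
  - exact: ltW.
  - exact/continuous_subspaceT/bessel_neumann_continuous.
  - by rewrite ge_min le_max gt0 (ltW g0) orbT.
  rewrite in_itv/= => /andP[s0 st] gs; exists s => //; rewrite st andbT lt_neqAle s0 andbT.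
  by apply/eqP => E; move: g0; rewrite {2}E gs ltxx.
have g_gt0 t : 0 < t < T -> 0 < bessel_neumann m.+1 t.
  move=> /andP[t0 tT]; rewrite ltNge; apply/negP => gt0.
  have [|s /andP[s0 st] gs] := ivt t _ gt0; first by rewrite t0 ltW.
  by have := gN0 s; rewrite s0 (le_lt_trans st tT) gs eqxx => /(_ isT).
have f1 := bessel_gt0_of_neumann g_gt0.
have f2 : forall t, 0 < t <= T -> 0 < bessel m.+2 t.
  by apply: bessel_gt0S => t /andP[t0 tT]; apply: f1; rewrite t0 ltW.
have f3 : forall t, 0 < t <= T -> 0 < bessel m.+3 t.
  by apply: bessel_gt0S => t /andP[t0 tT]; apply: f2; rewrite t0 ltW.
have gT : bessel_neumann m.+1 T < 0.
  have m2 : m.+2%:R != 0 :> R by rewrite pnatr_eq0.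
  have E : T / (2 * m.+2%:R) = m.+1%:R by rewrite /T; field.
  rewrite /bessel_neumann E (bessel_contiguous m.+1).
  rewrite mulrDr opprD addNKr oppr_lt0 !mulr_gt0 ?ltr0n ?invr_gt0 ?mulr_gt0 ?ltr0n//.
  by apply: f3; rewrite T0 lexx.
(* By continuity the value is already negative slightly before [T]. *)
have nT : \forall t \near T, bessel_neumann m.+1 t < 0.
  exact: (cvgr_lt _ (@bessel_neumann_continuous m.+1 T)).
have [e/= e0 eT] := (nbhs_ballP _ _).1 nT.
pose d := Num.min (e / 2) (T / 2).
have d0 : 0 < d by rewrite /d lt_min !divr_gt0.
have dT : d < T by apply: (@le_lt_trans _ _ (T / 2)); [by rewrite /d ge_min lexx orbT|lra].
have de : d < e by apply: (@le_lt_trans _ _ (e / 2)); [by rewrite /d ge_min lexx|lra].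
have := eT (T - d); rewrite /ball/= opprB addrC subrK gtr0_norm// => /(_ de).
by rewrite ltNge ltW// g_gt0// subr_gt0 dT/= ltrBlDr ltrDl.
Qed.

End Bessel.

(** * The derivatives of exp (- 1 / s) *)

Section Cutoff.
Variable R : realType.
Implicit Types (k n : nat) (s : R).

(** The polynomial [p_k] such that [exp (- 1 / s)] has [k]-th derivative
    [p_k (1 / s) exp (- 1 / s)]. *)
Fixpoint bump_poly k : {poly R} :=
  if k is k'.+1 then 'X^2 * (bump_poly k' - (bump_poly k')^`()) else 1.

(** All derivatives of [exp (- 1 / s)] extend by [0] to [s <= 0]. Indexing them by [k] gives the
    tower of derivatives that [smooth_comp] asks for. *)
Definition bump k s : R :=
  if 0 < s then (bump_poly k).[s^-1] * expR (- s^-1) else 0.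

Lemma expn_le_expR n (y : R) : 0 <= y -> y ^+ n <= n`!%:R * expR y.
Proof.
move=> y0; case: n => [|n]; first by rewrite expr0 fact0 mul1r -expR0 ler_expR.
rewrite mulrC -ler_pdivrMr ?ltr0n ?fact_gt0//; apply: le_trans (expR_ge1Dxn n y0).
by rewrite lerDr.
Qed.

Lemma poly_le_expR (p : {poly R}) :
  exists2 C, 0 <= C & forall y, 0 <= y -> `|p.[y]| * expR (- y) <= C.
Proof.
exists (\sum_(i < size p) `|p`_i| * i`!%:R); first by apply: sumr_ge0 => i _; rewrite mulr_ge0.
move=> y y0; rewrite expRN ler_pdivrMr ?expR_gt0// horner_coef mulr_suml.
apply: (le_trans (ler_norm_sum _ _ _)); apply: ler_sum => i _.
by rewrite normrM -mulrA ler_wpM2l// ger0_norm ?exprn_ge0// expn_le_expR.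
Qed.

Lemma bump_le0 k s : s <= 0 -> bump k s = 0.
Proof. by rewrite /bump ltNge => ->. Qed.

Lemma bump_gt0 k s : 0 < s -> bump k s = (bump_poly k).[s^-1] * expR (- s^-1).
Proof. by rewrite /bump => ->. Qed.

Lemma is_derive_bump_gt0 (p : {poly R}) s : 0 < s ->
  is_derive s (1 : R) (fun x : R => p.[x^-1] * expR (- x^-1))
    (('X^2 * (p - p^`())).[s^-1] * expR (- s^-1)).
Proof.
move=> s0.
have dV : is_derive s (1 : R) (fun x : R => x^-1) (- s ^- 2).
  have := @is_deriveV R (fun x : R => x) s 1 1 (lt0r_neq0 s0) (is_derive_id _ _).
  by rewrite /GRing.scale/= mulr1.
have dp := @is_derive1_comp _ _ (fun x : R => x^-1) _ _ _ (is_derive_poly p (s^-1)) dV.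
have dN : is_derive s (1 : R) (fun x : R => - x^-1) (- - s ^- 2) by exact: is_deriveN.
have de := @is_derive1_comp _ _ (fun x : R => - x^-1) _ _ _ (is_derive_expR (- s^-1)) dN.
apply: (is_derive_eq (is_derive1M dp de)).
rewrite hornerM hornerXn hornerD hornerN /= -exprVn.
move: (s^-1) => y; ring.
Qed.

(** At [0] the difference quotient [bump k h / h] is [O (h)], because [bump k h / h^2] is a
    polynomial in [1 / h] times [exp (- 1 / h)], hence bounded. *)
Lemma is_derive_bump k s : is_derive s (1 : R) (bump k) (bump k.+1 s).
Proof.
have [s0|s0|->] := ltgtP s 0.
- rewrite bump_le0 ?ltW//.
  apply: (@near_eq_is_derive _ _ _ (fun=> 0) (bump k)).
    near=> x; rewrite bump_le0// ltW//.
    by near: x; exact: lt_nbhsl.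
- rewrite bump_gt0//.
  apply: (@near_eq_is_derive _ _ _
    (fun x : R => (bump_poly k).[x^-1] * expR (- x^-1)) (bump k)).
    near=> x; rewrite bump_gt0//.
    by near: x; exact: lt_nbhsr.
  exact: is_derive_bump_gt0.
rewrite bump_le0//.
have [C C0 HC] := poly_le_expR ('X^2 * bump_poly k).
have HB x : `|bump k x| <= C * x ^+ 2.
  have [x0|x0] := leP x 0; first by rewrite bump_le0// normr0 mulr_ge0// sqr_ge0.
  rewrite bump_gt0// -ler_pdivrMr ?exprn_gt0// -exprVn mulrC.
  have xV0 : 0 <= x^-1 by rewrite invr_ge0 ltW.
  have := HC _ xV0; rewrite hornerM hornerXn normrM (ger0_norm (exprn_ge0 _ xV0)).
  by rewrite normrM (ger0_norm (expR_ge0 _)) mulrA.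
have C1 : 0 < C + 1 by rewrite ltr_wpDl.
have cv : h^-1 *: ((bump k \o shift 0) (h *: 1) - bump k 0) @[h --> 0^'] --> (0 : R).
  apply/cvgrPdist_le => e e0; near=> h.
  have h0 : h != 0 by near: h; exact: nbhs_dnbhs_neq.
  rewrite sub0r normrN (@bump_le0 k 0)// subr0 /= addr0 /GRing.scale/= mulr1 normrM normfV.
  rewrite ler_pdivrMl ?normr_gt0//; apply: (le_trans (HB _)).
  rewrite -real_normK ?num_real// expr2 mulrA mulrC ler_wpM2l//.
  have : `|h| <= e / (C + 1).
    near: h; apply: dnbhs0_le; by rewrite divr_gt0.
  rewrite ler_pdivlMr// mulrC; apply: le_trans.
  by rewrite ler_wpM2r// lerDl.
by split; [apply/cvg_ex; exists 0|exact/cvg_lim].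
Unshelve. all: by end_near. Qed.

Lemma bump0_itv s : 0 <= bump 0 s <= 1.
Proof.
have [s0|s0] := leP s 0; first by rewrite bump_le0// lexx ler01.
rewrite bump_gt0//= hornerC mul1r expR_ge0/= -expR0 ler_expR oppr_le0 invr_ge0.
exact: ltW.
Qed.

(** For [s = n rho - 1] the expression [(s + 1) * bump 1 s] is [rho] times the derivative with
    respect to [rho] of the cutoff [bump 0 (n rho - 1)]. It is bounded uniformly in [n], and by
    [bump1_cvg] it tends to [0] where [rho > 0]. *)
Lemma bump1_le : exists2 C, 0 <= C & forall s, `|(s + 1) * bump 1 s| <= C.
Proof.
have [C C0 HC] := poly_le_expR ('X + 'X^2).
exists C => // s.
have [s0|s0] := leP s 0; first by rewrite bump_le0// mulr0 normr0.
have sV0 : 0 <= s^-1 by rewrite invr_ge0 ltW.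
apply: le_trans (HC _ sV0); rewrite bump_gt0// mulrA normrM.
rewrite (ger0_norm (expR_ge0 _)) ler_wpM2r ?expR_ge0// /= derivC subr0 mulr1.
rewrite hornerD hornerXn hornerX (_ : (s + 1) * _ = s^-1 + s^-1 ^+ 2)//.
have sn0 : s != 0 by exact: lt0r_neq0.
by field.
Qed.

Lemma cvg_lin_infty (rho : R) : 0 < rho -> (n%:R * rho - 1)^-1 @[n --> \oo] --> (0 : R).
Proof.
move=> r0; apply/gtr0_cvgV0.
  near=> n; rewrite subr_gt0 -ltr_pdivrMr// mul1r; near: n.
  exact: nbhs_infty_gtr.
apply/cvgryPge => A; near=> n; rewrite lerBrDr -ler_pdivrMr//; near: n.
exact: nbhs_infty_ger.
Unshelve. all: by end_near. Qed.

Lemma bump0_cvg (rho : R) : 0 < rho -> bump 0 (n%:R * rho - 1) @[n --> \oo] --> (1 : R).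
Proof.
move=> r0; have cv : expR (- (n%:R * rho - 1)^-1) @[n --> \oo] --> (1 : R).
  rewrite [X in _ --> X](_ : _ = expR (- 0)); last by rewrite oppr0 expR0.
  apply: continuous_cvg; first exact: continuous_expR.
  exact: (cvgN (cvg_lin_infty r0)).
apply: cvg_trans cv; apply: near_eq_cvg; near=> n.
rewrite bump_gt0/= ?hornerC ?mul1r// subr_gt0 -ltr_pdivrMr// mul1r; near: n.
exact: nbhs_infty_gtr.
Unshelve. all: by end_near. Qed.

Lemma bump1_cvg (rho : R) : 0 < rho ->
  n%:R * rho * bump 1 (n%:R * rho - 1) @[n --> \oo] --> (0 : R).
Proof.
move=> r0.
have cy := cvg_lin_infty r0.
have cv : ((n%:R * rho - 1)^-1 + (n%:R * rho - 1)^-1 ^+ 2) *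
   expR (- (n%:R * rho - 1)^-1) @[n --> \oo] --> (0 : R).
  rewrite [X in _ --> X](_ : _ = (0 + 0 * 0) * expR (- 0)); last by rewrite mul0r addr0 mul0r.
  apply: cvgM; first by apply: cvgD => //; apply: cvgM.
  by apply: continuous_cvg; [exact: continuous_expR|exact: cvgN].
apply: cvg_trans cv; apply: near_eq_cvg; near=> n.
have s0 : 0 < n%:R * rho - 1.
  by rewrite subr_gt0 -ltr_pdivrMr// mul1r; near: n; exact: nbhs_infty_gtr.
rewrite bump_gt0//= derivC subr0 mulr1 hornerXn mulrA; congr (_ * _).
move: s0; set s := _ - 1 => s0; have -> : n%:R * rho = s + 1 by rewrite /s subrK.
have sn0 : s != 0 by exact: lt0r_neq0.
by field.
Unshelve. all: by end_near. Qed.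

End Cutoff.

(** * Integration over bounded subsets of the plane *)

Section Integration.
Variable R : realType.
Implicit Types (f g u v phi : R * R -> R) (z : R * R) (Omega : set (R * R)) (M : R).

Local Notation mu := (@lebesgue_measure R).
Local Notation mu2 := (lebesgue2 R).

(** The norm of [R * R] is the sup norm, so these are the balls that exhaust the plane. *)
Definition square M : set (R * R) := [set z | `|z.1| < M /\ `|z.2| < M].

Lemma squareE M : square M = `]- M, M[%classic `*` `]- M, M[%classic.
Proof.
by apply/seteqP; split=> -[x y] /=; rewrite /square/= !in_itv/= !ltr_norml.
Qed.

Lemma open_square M : open (square M).
Proof.
rewrite (_ : square M = fst @^-1` `]- M, M[ `&` snd @^-1` `]- M, M[).
  by apply: openI; apply: open_comp => [z _|]; [exact: cvg_fst|exact: interval_open|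
    exact: cvg_snd|exact: interval_open].
by apply/seteqP; split=> -[x y] /=; rewrite /square/= !in_itv/= !ltr_norml.
Qed.

Lemma measurable_square M : measurable (square M : set (plane R)).
Proof. by apply: open_measurable_plane; exact: open_square. Qed.

Lemma lebesgue2X (A B : set R) : measurable A -> measurable B ->
  mu2 (A `*` B) = (mu A * mu B)%E.
Proof. by move=> mA mB; exact: product_measure1E. Qed.

Lemma lebesgue2_square_fin M : (mu2 (square M) < +oo)%E.
Proof.
rewrite squareE lebesgue2X; try exact: measurable_itv.
by rewrite lebesgue_measure_itv/=; case: ifP => _; rewrite ?mule0// ltry.
Qed.

Lemma continuous_square_bounded M f : continuous f ->
  exists2 C, 0 <= C & forall z, square M z -> `|f z| <= C.
Proof.
move=> cf; have cK : compact (`[- M, M] `*` `[- M, M] : set (R * R)).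
  by apply: compact_setX; exact: segment_compact.
have := @continuous_compact _ _ f _ (continuous_subspaceT cf) cK.
move=> /compact_bounded[C [_ /(_ (`|C| + 1))]].
rewrite (le_lt_trans (ler_norm C)) ?ltrDl// => /(_ isT) H.
exists (`|C| + 1); first by rewrite addr_ge0.
move=> z [z1 z2]; apply: H; exists z => //=.
by split => /=; rewrite in_itv/= -ler_norml ltW.
Qed.

Lemma bounded_subset_square Omega : bounded_set Omega ->
  exists2 M, 0 < M & Omega `<=` square M.
Proof.
move=> [M [_ /(_ (`|M| + 1))]].
rewrite (le_lt_trans (ler_norm M)) ?ltrDl// => /(_ isT) H.
exists (`|M| + 2); first by rewrite ltr_wpDl.
move=> z /H /=; rewrite prod_normE ge_max => /andP[z1 z2].
by split; [apply: le_lt_trans z1 _|apply: le_lt_trans z2 _]; rewrite ltrD2l ltr1n.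
Qed.

Lemma continuous_integrable Omega M f :
  measurable (Omega : set (plane R)) -> Omega `<=` square M -> continuous f ->
  mu2.-integrable Omega (EFin \o f).
Proof.
move=> mO OM cf; apply: measurable_bounded_integrable => //.
- apply: le_lt_trans (lebesgue2_square_fin M).
  by apply: le_measure => //; rewrite inE//; exact: measurable_square.
- exact: continuous_measurable_plane.
- have [C C0 HC] := continuous_square_bounded M cf.
  exists C; split; first exact: num_real.
  by move=> x Cx z Oz /=; rewrite (le_trans (HC _ (OM _ Oz)))// ltW.
Qed.

Lemma RintegralT_supp Omega f : (forall z, ~ Omega z -> f z = 0) ->
  \int[mu2]_(z in Omega) f z = \int[mu2]_z f z.
Proof.
move=> f0; rewrite Rintegral_mkcond; congr Rintegral; apply/funext => z.
by rewrite patchE; case: ifPn => // /negP; rewrite inE => /f0.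
Qed.

Lemma integrableT_supp Omega f : measurable (Omega : set (plane R)) ->
  (forall z, ~ Omega z -> f z = 0) ->
  mu2.-integrable Omega (EFin \o f) -> mu2.-integrable setT (EFin \o f).
Proof.
move=> mO f0 /(integrable_mkcond _ mO).
rewrite (_ : (_ \_ _) = EFin \o f)//; apply/funext => z.
by rewrite patchE/=; case: ifPn => // /negP; rewrite inE => /f0 ->.
Qed.

Lemma integral_derive_supp M (h h' : R -> R) : 0 < M ->
  (forall x : R, is_derive x (1 : R) h (h' x)) -> continuous h' ->
  h M = 0 -> h (- M) = 0 -> (forall x, M <= `|x| -> h' x = 0) ->
  (\int[mu]_x (h' x)%:E = 0)%E.
Proof.
move=> M0 dh ch' hM hNM h'0.
have ch := is_derive_continuous dh.
transitivity (\int[mu]_(x in `[(- M)%R, M]) (h' x)%:E)%E.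
  rewrite [RHS]integral_mkcond; apply: eq_integral => x _.
  rewrite patchE; case: ifPn => // /negP; rewrite inE/= in_itv/= -ler_norml.
  by move=> /negP; rewrite -ltNge => /ltW/h'0 ->.
rewrite (@continuous_FTC2 _ h' h).
- by rewrite hM hNM subee.
- lra.
- exact: continuous_subspaceT.
- split.
  + by move=> x _; have [] := dh x.
  + by apply: cvg_at_right_filter; exact: ch.
  + by apply: cvg_at_left_filter; exact: ch.
- by move=> x _; rewrite derive1E; exact: (@derive_val _ _ _ _ _ _ _ (dh x)).
Qed.

(** Fubini and the fundamental theorem of calculus on the lines parallel to the axes. *)
Lemma Rintegral_dx_eq0 M f f1 f2 : 0 < M -> gradient f f1 f2 ->
  continuous f1 -> continuous f2 ->
  (forall z, ~ square M z -> [/\ f z = 0, f1 z = 0 & f2 z = 0]) ->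
  \int[mu2]_z f1 z = 0 /\ \int[mu2]_z f2 z = 0.
Proof.
move=> M0 df cf1 cf2 f0.
have i1 : mu2.-integrable setT (EFin \o f1).
  apply: (@integrableT_supp (square M)); first exact: measurable_square.
    by move=> z /f0[].
  apply: (@continuous_integrable _ M) => //; exact: measurable_square.
have i2 : mu2.-integrable setT (EFin \o f2).
  apply: (@integrableT_supp (square M)); first exact: measurable_square.
    by move=> z /f0[].
  apply: (@continuous_integrable _ M) => //; exact: measurable_square.
have N1 x y : M <= `|x| -> ~ square M (x, y) by rewrite /square/= leNgt => /negP h [].
have N2 x y : M <= `|y| -> ~ square M (x, y) by rewrite /square/= leNgt => /negP h [].
split.
- rewrite /Rintegral -(integral21_prod_meas1 i1) integral0_eq// => y _.
  apply: (@integral_derive_supp M (fun x => f (x, y))) => //.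
  + by move=> x; apply/is_derive_slice1; have [] := df (x, y).
  + move=> x; apply: (@continuous_comp _ _ _ (fun t : R => (t, y)) f1); last exact: cf1.
    by apply: (@cvg_pair _ _ _ (nbhs x) (nbhs x) (nbhs y)); [exact: cvg_id|exact: cvg_cst].
  + by have [] := f0 (M, y) (N1 _ _ (ler_norm _)).
  + by have [] := f0 (- M, y) (N1 _ _ _); rewrite // normrN ler_norm.
  + by move=> x Mx; have [] := f0 (x, y) (N1 _ _ Mx).
- rewrite /Rintegral -(integral12_prod_meas1 i2) integral0_eq// => x _.
  apply: (@integral_derive_supp M (fun y => f (x, y))) => //.
  + by move=> y; apply/is_derive_slice2; have [] := df (x, y).
  + move=> y; apply: (@continuous_comp _ _ _ (fun t : R => (x, t)) f2); last exact: cf2.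
    by apply: (@cvg_pair _ _ _ (nbhs y) (nbhs x) (nbhs y)); [exact: cvg_cst|exact: cvg_id].
  + by have [] := f0 (x, M) (N2 _ _ (ler_norm _)).
  + by have [] := f0 (x, - M) (N2 _ _ _); rewrite // normrN ler_norm.
  + by move=> y My; have [] := f0 (x, y) (N2 _ _ My).
Qed.

End Integration.

(** * From classical to weak Neumann eigenfunctions *)

Section Weak.
Variable R : realType.
Implicit Types (f g u v phi : R * R -> R) (z : R * R) (Omega : set (R * R)) (M : R).

Local Notation mu := (@lebesgue_measure R).
Local Notation mu2 := (lebesgue2 R).

Lemma dx_off_support phi z : ~ closure [set z | phi z != 0] z ->
  [/\ phi z = 0, dx1 phi z = 0 & dx2 phi z = 0].
Proof.
move=> Nz; have nz : \forall w \near z, (fun=> 0) w = phi w.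
  have : nbhs z (~` closure [set z | phi z != 0]).
    by apply: open_nbhs_nbhs; split => //; exact/closed_openC/closed_closure.
  apply: filterS => w /= Nw; apply/esym/eqP; apply: contrapT => /negP pw.
  by apply: Nw; exact: subset_closure.
split.
- by rewrite -(nbhs_singleton nz).
- by rewrite /dx1 -(near_eq_derive _ nz) derive_cst.
- by rewrite /dx2 -(near_eq_derive _ nz) derive_cst.
Qed.

Lemma eq_integral_on Omega f g : (forall z, Omega z -> f z = g z) ->
  \int[mu2]_(z in Omega) f z = \int[mu2]_(z in Omega) g z.
Proof. by move=> fg; apply: eq_Rintegral => z; rewrite inE; exact: fg. Qed.

Lemma integrableM_continuous Omega M u g :
  measurable (Omega : set (plane R)) -> Omega `<=` square M -> continuous g ->
  mu2.-integrable Omega (EFin \o u) ->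
  mu2.-integrable Omega (EFin \o (fun z => u z * g z)).
Proof.
move=> mO OM cg iu.
have -> : EFin \o (fun z => u z * g z) = ((EFin \o u) \* (EFin \o g))%E.
  by apply/funext => z /=; rewrite EFinM.
apply: integrableMl => //; first exact: continuous_measurable_plane.
have [C C0 HC] := continuous_square_bounded M cg.
exists C; split; first exact: num_real.
by move=> x Cx z Oz /=; rewrite (le_trans (HC _ (OM _ Oz)))// ltW.
Qed.

(** [|u| <= 1 + u^2], and [Omega] has finite measure. *)
Lemma square_integrable_integrable Omega M u :
  measurable (Omega : set (plane R)) -> Omega `<=` square M ->
  square_integrable Omega u -> mu2.-integrable Omega (EFin \o u).
Proof.
move=> mO OM [mu_ iu2].
apply: (@le_integrable _ _ _ mu2 Omega mO _ (EFin \o (fun z => 1 + u z ^+ 2))) => //.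
- exact/measurable_EFinP.
- move=> z _ /=; rewrite lee_fin [leRHS]ger0_norm ?addr_ge0 ?sqr_ge0//.
  rewrite -real_normK ?num_real//; have := sqr_ge0 (`|u z| - 1).
  by have := normr_ge0 (u z); move: `|u z| => a; nra.
- have i1 : mu2.-integrable Omega (EFin \o (fun=> 1)).
    by apply: (continuous_integrable mO OM) => z; exact: cst_continuous.
  by apply: eq_integrable (integrableD mO i1 iu2) => // z _; rewrite /= EFinD.
Qed.

Lemma continuous_square_integrable Omega M g :
  measurable (Omega : set (plane R)) -> Omega `<=` square M -> continuous g ->
  square_integrable Omega g.
Proof.
move=> mO OM cg; split; first exact: continuous_measurable_plane.
apply: (@continuous_integrable _ _ M (fun z => g z ^+ 2)) => //.
move=> z; apply: (@continuous_comp _ _ _ g (fun x : R => x ^+ 2)); first exact: cg.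
exact: exprn_continuous.
Qed.

(** The product [v * phi] is differentiable on the whole plane with compact support, so its
    partial derivatives integrate to [0]. *)
Lemma smooth_H1_grad Omega v : open Omega -> bounded_set Omega -> smooth v ->
  H1_grad Omega v (dx1 v) (dx2 v).
Proof.
move=> oO bO sv; have [M M0 OM] := bounded_subset_square bO.
have mO := open_measurable_plane oO.
have cv := smooth_continuous sv.
have cv1 := smooth_continuous (smooth_dx1 sv).
have cv2 := smooth_continuous (smooth_dx2 sv).
split; try exact: (continuous_square_integrable mO OM).
move=> phi [sphi _ supp].
have cphi := smooth_continuous sphi.
have cphi1 := smooth_continuous (smooth_dx1 sphi).
have cphi2 := smooth_continuous (smooth_dx2 sphi).
have off z : ~ Omega z -> [/\ phi z = 0, dx1 phi z = 0 & dx2 phi z = 0].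
  by move=> Nz; apply: dx_off_support => /supp.
have ci f g : continuous f -> continuous g ->
    mu2.-integrable Omega (EFin \o (fun z => f z * g z)).
  move=> cf cg; apply: (integrableM_continuous mO OM cg).
  exact: (continuous_integrable mO OM).
have cM f g : continuous f -> continuous g -> continuous (fun z => f z * g z).
  by move=> cf cg z; apply: cvgM; [exact: cf|exact: cg].
have cD f g : continuous f -> continuous g -> continuous (fun z => f z + g z).
  by move=> cf cg z; apply: cvgD; [exact: cf|exact: cg].
have [] := @Rintegral_dx_eq0 _ M _ _ _ M0
    (gradientM (smooth_gradient sv) (smooth_gradient sphi)).
- by apply: cD; exact: cM.
- by apply: cD; exact: cM.
- move=> z Nz; have [|-> -> ->] := off z; first by move=> /OM.
  by rewrite !mulr0 addr0.
rewrite -!(@RintegralT_supp _ Omega); last 2 first.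
- by move=> z /off[-> _ ->]; rewrite !mulr0 addr0.
- by move=> z /off[-> -> _]; rewrite !mulr0 addr0.
rewrite RintegralD//; [|exact: ci|exact: ci].
rewrite RintegralD//; [|exact: ci|exact: ci].
have sum0 (a b : R) : a + b = 0 -> b = - a by move=> /(canRL (addKr _)); rewrite addr0.
move=> /sum0 E1 /sum0 E2; split; [exact: E1|exact: E2].
Qed.

Lemma Rintegral_dominated_cvg Omega (F : nat -> R * R -> R) f g :
  measurable (Omega : set (plane R)) ->
  (forall n, mu2.-integrable Omega (EFin \o F n)) ->
  mu2.-integrable Omega (EFin \o f) -> mu2.-integrable Omega (EFin \o g) ->
  (forall z, Omega z -> F n z @[n --> \oo] --> f z) ->
  (forall n z, Omega z -> `|F n z| <= g z) ->
  \int[mu2]_(z in Omega) F n z @[n --> \oo] --> \int[mu2]_(z in Omega) f z.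
Proof.
move=> mO iF i_f ig Ff Fg.
have cvE z : Omega z -> (F n z)%:E @[n --> \oo] --> (f z)%:E.
  by move=> Oz; apply: cvg_EFin; [exact: nearW|exact: Ff].
have h1 : {ae mu2, forall z, Omega z -> (EFin \o F n) z @[n --> \oo] --> (EFin \o f) z}.
  by apply: aeW => z; exact: cvE.
have h2 : {ae mu2, forall z n, Omega z -> (`|(EFin \o F n) z| <= (EFin \o g) z)%E}.
  by apply: aeW => z n Oz; rewrite /= lee_fin; exact: Fg.
have [_ _] := @dominated_convergence _ _ _ mu2 Omega mO (fun n => EFin \o F n)
  (EFin \o f) (EFin \o g) (fun n => measurable_int _ (iF n)) (measurable_int _ i_f) h1 ig h2.
rewrite -(fineK (integrable_fin_num mO i_f)) => /fine_cvg; exact.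
Qed.

(** Supported in [{rho1 >= 1 / n, rho2 >= 1 / n}] and increasing to [1] on
    [{rho1 > 0, rho2 > 0}] as [n] grows. With two defining functions the sides that meet at a
    corner are treated separately. *)
Definition cutoff (rho1 rho2 : R * R -> R) (n : nat) z :=
  bump 0 (n%:R * rho1 z - 1) * bump 0 (n%:R * rho2 z - 1).

Section WeakNeumann.
Variables (Omega : set (R * R)) (rho1 rho2 v : R * R -> R) (lam C0 : R).
Hypotheses (bO : bounded_set Omega) (s1 : smooth rho1) (s2 : smooth rho2).
Hypotheses (sv : smooth v) (OE : Omega = [set z | 0 < rho1 z /\ 0 < rho2 z]).
Hypothesis Lv : forall z, Omega z -> dx1 (dx1 v) z + dx2 (dx2 v) z = - lam * v z.
Hypothesis N1 : forall z, Omega z ->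
  `|dx1 rho1 z * dx1 v z + dx2 rho1 z * dx2 v z| <= C0 * rho1 z.
Hypothesis N2 : forall z, Omega z ->
  `|dx1 rho2 z * dx1 v z + dx2 rho2 z * dx2 v z| <= C0 * rho2 z.

Local Notation chi := (cutoff rho1 rho2).
Let r1 n z := n%:R * rho1 z - 1.
Let r2 n z := n%:R * rho2 z - 1.

Lemma open_neumann : open Omega.
Proof.
rewrite OE (_ : [set _ | _] = rho1 @^-1` [set x | 0 < x] `&` rho2 @^-1` [set x | 0 < x]) //.
apply: openI; apply: open_comp; try exact: open_gt.
- by move=> z _; exact: smooth_continuous.
- by move=> z _; exact: smooth_continuous.
Qed.

Let smooth_r rho n : smooth rho -> smooth (fun z => n%:R * rho z - 1).
Proof.
by move=> sr; apply: smoothD; [apply: smoothM => //; exact: smooth_cst|exact: smooth_cst].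
Qed.

Let smooth_bump k rho : smooth rho -> smooth (fun z => bump k (rho z)).
Proof. exact: (@smooth_comp _ (@bump R) _ k (@is_derive_bump R)). Qed.

Lemma smooth_cutoff n : smooth (chi n).
Proof. by apply: smoothM; apply: smooth_bump; exact: smooth_r. Qed.

Lemma gradient_cutoff n : gradient (chi n)
  (fun z => bump 1 (r1 n z) * (n%:R * dx1 rho1 z) * bump 0 (r2 n z) +
            bump 0 (r1 n z) * (bump 1 (r2 n z) * (n%:R * dx1 rho2 z)))
  (fun z => bump 1 (r1 n z) * (n%:R * dx2 rho1 z) * bump 0 (r2 n z) +
            bump 0 (r1 n z) * (bump 1 (r2 n z) * (n%:R * dx2 rho2 z))).
Proof.
have gr rho : smooth rho -> gradient (fun z => n%:R * rho z - 1)
    (fun z => n%:R * dx1 rho z) (fun z => n%:R * dx2 rho z).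
  move=> sr; have dr := gradient_linear n%:R (smooth_gradient sr).
  by apply: gradient_eq (gradientD dr (gradient_cst (-1))) _ _ => z; exact: addr0.
by apply: gradientM; apply: (gradient_comp (@is_derive_bump R 0)); exact: gr.
Qed.

Lemma cutoff_itv n z : 0 <= chi n z <= 1.
Proof.
rewrite /cutoff; have /andP[a0 a1] := bump0_itv (n%:R * rho1 z - 1).
have /andP[b0 b1] := bump0_itv (n%:R * rho2 z - 1).
by rewrite mulr_ge0//= mulr_ile1.
Qed.

Lemma cutoff_cvg z : Omega z -> chi n z @[n --> \oo] --> (1 : R).
Proof.
rewrite OE => -[z1 z2]; rewrite -[X in _ --> X]mulr1.
by apply: cvgM; exact: bump0_cvg.
Qed.

Lemma cutoff_test n g : smooth g -> test_function Omega (fun z => chi n z * g z).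
Proof.
move=> sg; pose K := [set z | 0 <= r1 n z /\ 0 <= r2 n z].
have cK : closed K.
  rewrite (_ : K = r1 n @^-1` [set x | 0 <= x] `&` r2 n @^-1` [set x | 0 <= x]) //.
  by apply: closedI; apply: (closed_comp (fun z _ => smooth_continuous (smooth_r n _) (x := z)));
    try exact: closed_ge.
have sK : closure [set z | chi n z * g z != 0] `<=` K.
  rewrite [X in _ `<=` X](closure_id _).1//; apply: closureS => z /=.
  rewrite !mulf_eq0 !negb_or => /andP[/andP[a b] _]; split; rewrite leNgt.
  - by apply: contra a => /ltW/bump_le0 ->.
  - by apply: contra b => /ltW/bump_le0 ->.
have KO : K `<=` Omega.
  have p (rho : R) : 0 <= n%:R * rho - 1 -> 0 < rho.
    rewrite subr_ge0 => p0; have [//|r0] := ltP 0 rho.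
    have := le_trans p0 (mulr_ge0_le0 (ler0n _ _) r0).
    by rewrite ler10.
  by rewrite OE => z [/p ? /p ?].
have [M M0 OM] := bounded_subset_square bO.
split; first by apply: smoothM => //; exact: smooth_cutoff.
  apply: (@subclosed_compact _ _ (`[- M, M] `*` `[- M, M] : set (R * R))).
  - exact: closed_closure.
  - by apply: compact_setX; exact: segment_compact.
  - by move=> z /sK/KO/OM[z1 z2]; split; rewrite /= in_itv/= -ler_norml ltW.
exact: subset_trans sK KO.
Qed.

(** The hypotheses [N1] and [N2] say that [grad v] is tangent to the level sets of [rho1] and
    [rho2] up to errors of order [rho1] and [rho2]. For [phi] in [H^1], its weak gradient tested
    against the compactly supported fields [chi_n grad v] gives
      [int phi (grad chi_n . grad v + chi_n (dx1 dx1 v + dx2 dx2 v))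
          = - int chi_n grad phi . grad v].
    The term [grad chi_n . grad v] is bounded by a combination of [n rho * bump 1 (n rho - 1)] for
    the two [rho], which is bounded and tends to [0]; dominated convergence turns the identity into
    Green's formula without a boundary term. *)
Lemma neumann_eigenfunction : neumann_eigenspace Omega lam v.
Proof.
have oO := open_neumann; have mO := open_measurable_plane oO.
have [M M0 OM] := bounded_subset_square bO.
have sv1 := smooth_dx1 sv; have sv2 := smooth_dx2 sv.
have sv11 := smooth_dx1 sv1; have sv22 := smooth_dx2 sv2.
exists (dx1 v), (dx2 v); split; first exact: smooth_H1_grad.
move=> phi h1 h2 [qphi qh1 qh2 weak].
have iphi := square_integrable_integrable mO OM qphi.
have ih1 := square_integrable_integrable mO OM qh1.
have ih2 := square_integrable_integrable mO OM qh2.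
have iM u g (iu : mu2.-integrable Omega (EFin \o u)) (sg : smooth g) :
    mu2.-integrable Omega (EFin \o (fun z => u z * g z)).
  by apply: (integrableM_continuous mO OM) => //; exact: smooth_continuous.
pose t1 n z := chi n z * dx1 v z; pose t2 n z := chi n z * dx2 v z.
have st1 n : smooth (t1 n) by apply: smoothM => //; exact: smooth_cutoff.
have st2 n : smooth (t2 n) by apply: smoothM => //; exact: smooth_cutoff.
pose flux n z := dx1 (chi n) z * dx1 v z + dx2 (chi n) z * dx2 v z.
pose lap z := dx1 (dx1 v) z + dx2 (dx2 v) z.
pose dotp z := h1 z * dx1 v z + h2 z * dx2 v z.
have idot : mu2.-integrable Omega (EFin \o dotp).
  by apply: eq_integrable (integrableD mO (iM _ _ ih1 sv1) (iM _ _ ih2 sv2)).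
have sflux n : smooth (flux n).
  have sc := smooth_cutoff n.
  exact: smoothD (smoothM (smooth_dx1 sc) sv1) (smoothM (smooth_dx2 sc) sv2).
have slap : smooth lap by exact: smoothD.
have divt n z : dx1 (t1 n) z + dx2 (t2 n) z = flux n z + chi n z * lap z.
  have sc := smooth_gradient (smooth_cutoff n).
  have [-> _] := gradient_dx (gradientM sc (smooth_gradient sv1)).
  have [_ ->] := gradient_dx (gradientM sc (smooth_gradient sv2)).
  by rewrite /flux /lap; ring.
have key n : \int[mu2]_(z in Omega) (phi z * (flux n z + chi n z * lap z)) =
    - (\int[mu2]_(z in Omega) (dotp z * chi n z)).
  have e1 : \int[mu2]_(z in Omega) (phi z * dx1 (t1 n) z) =
      - (\int[mu2]_(z in Omega) (h1 z * t1 n z)).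
    by have [e _] := weak _ (cutoff_test n sv1); exact: e.
  have e2 : \int[mu2]_(z in Omega) (phi z * dx2 (t2 n) z) =
      - (\int[mu2]_(z in Omega) (h2 z * t2 n z)).
    by have [_ e] := weak _ (cutoff_test n sv2); exact: e.
  have i1 := iM _ _ iphi (smooth_dx1 (st1 n)).
  have i2 := iM _ _ iphi (smooth_dx2 (st2 n)).
  have j1 := iM _ _ ih1 (st1 n).
  have j2 := iM _ _ ih2 (st2 n).
  transitivity (\int[mu2]_(z in Omega) (phi z * dx1 (t1 n) z + phi z * dx2 (t2 n) z)).
    by apply: eq_integral_on => z _; rewrite -mulrDr divt.
  transitivity (- (\int[mu2]_(z in Omega) (h1 z * t1 n z + h2 z * t2 n z))).
    rewrite (RintegralD mO i1 i2) (RintegralD mO j1 j2) opprD.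
    by congr (_ + _); [exact: e1|exact: e2].
  congr (- _); apply: eq_integral_on => z _; rewrite /dotp /t1 /t2.
  by move: (chi n z) => c; ring.
have [C1 C10 HC1] := bump1_le R.
have [K K0 HK] := continuous_square_bounded M (smooth_continuous slap).
have fluxE n z : flux n z =
    bump 1 (r1 n z) * n%:R * (dx1 rho1 z * dx1 v z + dx2 rho1 z * dx2 v z) * bump 0 (r2 n z) +
    bump 0 (r1 n z) * (bump 1 (r2 n z) * n%:R * (dx1 rho2 z * dx1 v z + dx2 rho2 z * dx2 v z)).
  by rewrite /flux; have [-> ->] := gradient_dx (gradient_cutoff n); ring.
have term rho n z : (0 <= rho z) ->
   `|dx1 rho z * dx1 v z + dx2 rho z * dx2 v z| <= C0 * rho z ->
   `|bump 1 (n%:R * rho z - 1) * n%:R * (dx1 rho z * dx1 v z + dx2 rho z * dx2 v z)| <=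
   `|C0| * `|n%:R * rho z * bump 1 (n%:R * rho z - 1)|.
  move=> rz /le_trans le; rewrite normrM.
  have /(ler_wpM2l (normr_ge0 (bump 1 (n%:R * rho z - 1) * n%:R))) := le _ (ler_norm _).
  move=> /le_trans; apply; rewrite -!normrM le_eqVlt; apply/orP; left; apply/eqP.
  by congr (`| _ |); ring.
have fluxle n z : Omega z -> `|flux n z| <=
    `|C0| * `|n%:R * rho1 z * bump 1 (r1 n z)| + `|C0| * `|n%:R * rho2 z * bump 1 (r2 n z)|.
  move=> Oz; rewrite fluxE; apply: (le_trans (ler_normD _ _)); apply: lerD.
  - rewrite normrM; have /andP[b0 b1] := bump0_itv (r2 n z).
    have r0 : 0 <= rho1 z by move: Oz; rewrite OE => -[/ltW].
    by apply: le_trans (term rho1 n z r0 (N1 Oz)); rewrite (ger0_norm b0) ler_piMr.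
  - rewrite normrM; have /andP[b0 b1] := bump0_itv (r1 n z).
    have r0 : 0 <= rho2 z by move: Oz; rewrite OE => -[_ /ltW].
    by apply: le_trans (term rho2 n z r0 (N2 Oz)); rewrite (ger0_norm b0) ler_piMl.
have flux_cvg z : Omega z -> flux n z @[n --> \oo] --> (0 : R).
  move=> Oz; apply/norm_cvg0P.
  apply: (@squeeze_cvgr _ _ _ _ (fun=> 0) (fun n =>
    `|C0| * `|n%:R * rho1 z * bump 1 (r1 n z)| + `|C0| * `|n%:R * rho2 z * bump 1 (r2 n z)|)).
  - by apply: nearW => n; rewrite normr_ge0/=; exact: fluxle.
  - exact: cvg_cst.
  - move: (Oz); rewrite OE => -[z1 z2].
    have tz (rho : R) : 0 < rho ->
        `|C0| * `|n%:R * rho * bump 1 (n%:R * rho - 1)| @[n --> \oo] --> (0 : R).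
      move=> rho0; rewrite -[X in _ --> X](mulr0 `|C0|); apply: cvgMr.
      by apply/norm_cvg0P; exact: bump1_cvg.
    by rewrite -[X in _ --> X](addr0 0); apply: cvgD; exact: tz.
have flux_bd n z : Omega z -> `|flux n z| <= `|C0| * C1 + `|C0| * C1.
  move=> Oz; apply: (le_trans (fluxle n z Oz)).
  have := HC1 (r1 n z); have := HC1 (r2 n z); rewrite /r1 /r2 !subrK => a b.
  by apply: lerD; exact: ler_wpM2l.
have lim1 : \int[mu2]_(z in Omega) (phi z * (flux n z + chi n z * lap z)) @[n --> \oo]
    --> \int[mu2]_(z in Omega) (phi z * lap z).
  apply: (@Rintegral_dominated_cvg _ _ _
    (fun z => `|phi z| * (`|C0| * C1 + `|C0| * C1 + K))) => //.
  - move=> n; apply: iM => //; apply: smoothD => //; apply: smoothM => //.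
    exact: smooth_cutoff.
  - exact: iM.
  - apply: iM; last exact: smooth_cst.
    exact: integrable_norm.
  - move=> z Oz; apply: cvgMr.
    rewrite [X in _ --> X](_ : _ = 0 + 1 * lap z); last by rewrite mul1r add0r.
    by apply: cvgD; [exact: flux_cvg|apply: cvgMl; exact: cutoff_cvg].
  - move=> n z Oz; rewrite normrM ler_wpM2l//; apply: (le_trans (ler_normD _ _)).
    apply: lerD; first exact: flux_bd.
    have /andP[c0 c1] := cutoff_itv n z.
    by rewrite normrM (ger0_norm c0) (le_trans _ (HK z (OM z Oz)))// ler_piMl.
have lim2 : \int[mu2]_(z in Omega) (dotp z * chi n z) @[n --> \oo]
    --> \int[mu2]_(z in Omega) dotp z.
  apply: (@Rintegral_dominated_cvg _ _ _ (fun z => `|dotp z|)) => //.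
  - by move=> n; apply: iM => //; exact: smooth_cutoff.
  - exact: integrable_norm.
  - by move=> z Oz; rewrite -[X in _ --> X]mulr1; apply: cvgMr; exact: cutoff_cvg.
  - move=> n z _; have /andP[c0 c1] := cutoff_itv n z.
    by rewrite normrM (ger0_norm c0) ler_piMr.
have lim3 : \int[mu2]_(z in Omega) (phi z * (flux n z + chi n z * lap z)) @[n --> \oo]
    --> - \int[mu2]_(z in Omega) dotp z.
  rewrite (_ : (fun n => _) = (fun n => - (\int[mu2]_(z in Omega) (dotp z * chi n z)))).
    exact: cvgN lim2.
  by apply/funext => n; exact: key.
have E := cvg_unique (@Rhausdorff R) lim1 lim3.
have iv := iM _ _ iphi sv.
transitivity (\int[mu2]_(z in Omega) dotp z).
  by apply: eq_integral_on => z _; rewrite /dotp; ring.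
transitivity (- \int[mu2]_(z in Omega) (phi z * lap z)); first by rewrite E opprK.
have -> : \int[mu2]_(z in Omega) (phi z * lap z) =
    - lam * \int[mu2]_(z in Omega) (phi z * v z).
  rewrite -(@RintegralZl _ _ _ mu2 Omega (fun z => phi z * v z) (- lam) mO iv).
  by apply: eq_integral_on => z Oz; rewrite /lap Lv//; ring.
rewrite mulNr opprK; congr (_ * _); apply: eq_integral_on => z _; exact: mulrC.
Qed.

End WeakNeumann.

End Weak.

(** * Cosine products on a rectangle *)

Section Cosines.
Variable R : realType.
Implicit Types (f g u v phi : R * R -> R) (z : R * R) (Omega : set (R * R)).

Local Notation mu2 := (lebesgue2 R).

Definition rect (L1 L2 : R) : set (R * R) :=
  [set z | 0 < z.1 < L1 /\ 0 < z.2 < L2].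

(** The product [t * (L - t)] serves as a smooth defining function for a pair of opposite
    sides. *)
Lemma itv_product_gt0 (L t : R) : 0 < L -> (0 < t * (L - t)) = (0 < t < L).
Proof.
move=> L0; apply/idP/andP => [p|[t0 tL]]; last by rewrite mulr_gt0// subr_gt0.
by split; rewrite ltNge; apply/negP => h; nra.
Qed.

Lemma rectE L1 L2 : 0 < L1 -> 0 < L2 -> rect L1 L2 =
  [set z | 0 < z.1 * (L1 - z.1) /\ 0 < z.2 * (L2 - z.2)].
Proof.
by move=> l1 l2; apply/seteqP; split=> z /=; rewrite !itv_product_gt0.
Qed.

Lemma rect_bounded L1 L2 : bounded_set (rect L1 L2).
Proof.
exists (Num.max `|L1| `|L2|); split; first exact: num_real.
move=> M; rewrite gt_max => /andP[M1 M2] z [/andP[a b] /andP[c d]] /=.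
rewrite prod_normE ge_max !gtr0_norm// (le_trans (ltW b) (le_trans (ler_norm _) (ltW M1))).
by rewrite (le_trans (ltW d) (le_trans (ler_norm _) (ltW M2))).
Qed.

(** All derivatives of [cos] are translates of [cos] by multiples of a quarter period. *)
Lemma smooth_cos_comp a f : smooth f -> smooth (fun z => cos (a * f z)).
Proof.
move=> sf; have [p cosDp] : exists p, forall x : R, cos (x + p) = - sin x.
  by exists (pi / 2); exact: cosDpihalf.
pose h k (x : R) := cos (x + k%:R * p).
have dh k x : is_derive (x : R) (1 : R) (h k) (h k.+1 x).
  have dl : is_derive x (1 : R) (fun x : R => x + k%:R * p) 1.
    by apply: is_derive_eq; rewrite addr0.
  have := @is_derive1_comp _ _ (fun x : R => x + k%:R * p) _ _ _
    (is_derive_cos _) dl.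
  by rewrite mulr1 /h -[k.+1%:R]natr1 mulrDl mul1r addrA cosDp.
have := @smooth_comp _ h (fun z => a * f z) 0%N dh (smoothM (smooth_cst a) sf).
by rewrite /h mul0r; under eq_fun do rewrite addr0.
Qed.

Definition coswave (a c : R) z := cos (a * z.1) * cos (c * z.2).

Lemma smooth_coswave a c : smooth (coswave a c).
Proof.
by apply: smoothM; apply: smooth_cos_comp; [exact: smooth_fst|exact: smooth_snd].
Qed.

Lemma gradient_coswave a c : gradient (coswave a c)
  (fun z => - a * sin (a * z.1) * cos (c * z.2))
  (fun z => - c * cos (a * z.1) * sin (c * z.2)).
Proof.
move=> z; have [d1 d2] := gradientM
  (gradient_comp (@is_derive_cos R) (gradient_linear a (@gradient_fst R)))
  (gradient_comp (@is_derive_cos R) (gradient_linear c (@gradient_snd R))) z.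
by split; [apply: (is_derive_eq d1)|apply: (is_derive_eq d2)]; ring.
Qed.

Lemma coswave_laplacian a c z :
  dx1 (dx1 (coswave a c)) z + dx2 (dx2 (coswave a c)) z =
  - (a ^+ 2 + c ^+ 2) * coswave a c z.
Proof.
have [-> ->] := gradient_dx (gradient_coswave a c).
have [-> _] := gradient_dx (gradientM
  (gradient_linear (- a) (gradient_comp (@is_derive_sin R) (gradient_linear a (@gradient_fst R))))
  (gradient_comp (@is_derive_cos R) (gradient_linear c (@gradient_snd R)))).
have [_ ->] := gradient_dx (gradientM
  (gradient_linear (- c) (gradient_comp (@is_derive_cos R) (gradient_linear a (@gradient_fst R))))
  (gradient_comp (@is_derive_sin R) (gradient_linear c (@gradient_snd R)))).
by rewrite /coswave; ring.
Qed.

Lemma norm_sin_le (x : R) : `|sin x| <= `|x|.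
Proof.
wlog x0 : x / 0 <= x => [H|].
  have [/H//|/ltW x0] := leP 0 x.
  by rewrite -normrN -sinN -(normrN x); apply: H; rewrite oppr_ge0.
move: x0; rewrite le_eqVlt => /predU1P[<-|x0]; first by rewrite sin0 normr0.
have [y _] := @MVT _ (@sin R) (@cos R) 0 x x0 (fun y _ => is_derive_sin y)
  (continuous_subspaceT (@continuous_sin R)).
rewrite sin0 !subr0 => ->; rewrite normrM ler_piMl//; exact: cos_max.
Qed.

(** Since [sin (a t)] vanishes at both ends, it is at most [|a| t] and at most [|a| (L - t)];
    averaging these bounds with the weights [(L - t) / L] and [t / L] gives the product. *)
Lemma norm_sin_le_edges (a L t : R) : 0 < t < L -> sin (a * L) = 0 ->
  `|sin (a * t)| <= 2 * `|a| / L * (t * (L - t)).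
Proof.
move=> /andP[t0 tL] saL; have L0 := lt_trans t0 tL.
have b1 : `|sin (a * t)| <= `|a| * t.
  by apply: le_trans (norm_sin_le _) _; rewrite normrM (gtr0_norm t0).
have b2 : `|sin (a * t)| <= `|a| * (L - t).
  have -> : `|sin (a * t)| = `|sin (a * (L - t))|.
    by rewrite mulrBr sinB saL mul0r sub0r normrN normrM sin0cos1// mul1r.
  by apply: le_trans (norm_sin_le _) _; rewrite normrM [`|L - t|]gtr0_norm// subr_gt0.
have a0 := normr_ge0 a.
rewrite mulrAC ler_pdivlMr//; move: b1 b2 a0.
move: `|sin (a * t)| `|a| => s A b1 b2 A0.
have := ler_wpM2r (ltW t0) b2.
have : 0 <= L - t by rewrite subr_ge0 ltW.
move=> /ler_wpM2r/(_ _ _ b1).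
nra.
Qed.

(** The left-hand side is the flux of [coswave] through the level sets of [t * (L - t)], with
    [w] the cosine of the other coordinate. *)
Lemma sin_flux_le (a L t w : R) : 0 < t < L -> sin (a * L) = 0 -> `|w| <= 1 ->
  `|(L - 2 * t) * (- a * sin (a * t) * w)| <= 2 * a ^+ 2 * (t * (L - t)).
Proof.
move=> tI sa w1; have /andP[t0 tL] := tI; have L0 := lt_trans t0 tL.
have LE : L * `|a| * (2 * `|a| / L * (t * (L - t))) = 2 * a ^+ 2 * (t * (L - t)).
  by rewrite -[a ^+ 2]real_normK ?num_real//; field; exact: lt0r_neq0.
have -> : `|(L - 2 * t) * (- a * sin (a * t) * w)| =
    `|L - 2 * t| * `|a| * (`|sin (a * t)| * `|w|).
  by rewrite !normrM normrN; ring.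
rewrite -LE; apply: ler_pM.
- exact: mulr_ge0.
- exact: mulr_ge0.
- by apply: ler_wpM2r => //; rewrite ler_norml; apply/andP; split; lra.
- by apply: le_trans (norm_sin_le_edges tI sa); rewrite ler_piMr.
Qed.

Lemma coswave_eigen (L1 L2 a c : R) : 0 < L1 -> 0 < L2 ->
  sin (a * L1) = 0 -> sin (c * L2) = 0 ->
  neumann_eigenspace (rect L1 L2) (a ^+ 2 + c ^+ 2) (coswave a c).
Proof.
move=> l1 l2 sa sc.
have srho (f : R * R -> R) L : smooth f -> smooth (fun z => f z * (L - f z)).
  by move=> sf; apply: smoothM => //; apply: smoothD; [exact: smooth_cst|exact: smooth_opp].
have grho f f1 f2 L : gradient f f1 f2 -> gradient (fun z => f z * (L - f z))
    (fun z => f1 z * (L - 2 * f z)) (fun z => f2 z * (L - 2 * f z)).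
  move=> df; have dL := gradientD (gradient_cst L) (gradient_opp df).
  by apply: gradient_eq (gradientM df dL) _ _ => z; ring.
have [E11 E12] := gradient_dx (grho _ _ _ L1 (@gradient_fst R)).
have [E21 E22] := gradient_dx (grho _ _ _ L2 (@gradient_snd R)).
have [V1 V2] := gradient_dx (gradient_coswave a c).
apply: (@neumann_eigenfunction _ _ (fun z => z.1 * (L1 - z.1)) (fun z => z.2 * (L2 - z.2))
  _ _ (2 * a ^+ 2 + 2 * c ^+ 2)).
- exact: rect_bounded.
- exact: srho (@smooth_fst R).
- exact: srho (@smooth_snd R).
- exact: smooth_coswave.
- exact: rectE.
- by move=> z _; exact: coswave_laplacian.
- move=> [x y] [/= xL yL]; rewrite E11 E12 V1 V2 /= !mul0r addr0 !mul1r.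
  apply: (le_trans (sin_flux_le xL sa (cos_max (c * y)))).
  have /andP[x0 x1] := xL.
  by apply: ler_wpM2r; [apply: mulr_ge0; lra|rewrite lerDl mulr_ge0 ?sqr_ge0].
- move=> [x y] [/= xL yL]; rewrite E21 E22 V1 V2 /= !mul0r add0r !mul1r.
  rewrite [- c * _ * _]mulrAC.
  apply: (le_trans (sin_flux_le yL sc (cos_max (a * x)))).
  have /andP[y0 y1] := yL.
  by apply: ler_wpM2r; [apply: mulr_ge0; lra|rewrite lerDr mulr_ge0 ?sqr_ge0].
Qed.

(** Each of the two eigenfunctions is an admissible test function for the other. *)
Lemma eigen_orthogonal Omega lam nu u v : neumann_eigenspace Omega lam u ->
  neumann_eigenspace Omega nu v -> lam != nu ->
  \int[mu2]_(z in Omega) (u z * v z) = 0.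
Proof.
move=> [g1 [g2 [Hu eu]]] [h1 [h2 [Hv ev]]] ne.
have e1 := eu _ _ _ Hv; have e2 := ev _ _ _ Hu.
have E1 : \int[mu2]_(z in Omega) (g1 z * h1 z + g2 z * h2 z) =
          \int[mu2]_(z in Omega) (h1 z * g1 z + h2 z * g2 z).
  by apply: eq_integral_on => z _; ring.
have E2 : \int[mu2]_(z in Omega) (u z * v z) = \int[mu2]_(z in Omega) (v z * u z).
  by apply: eq_integral_on => z _; ring.
have : (lam - nu) * \int[mu2]_(z in Omega) (u z * v z) = 0.
  by rewrite mulrBl -e1 E1 e2 E2 subrr.
by move=> /eqP; rewrite mulf_eq0 subr_eq0 (negbTE ne) => /eqP.
Qed.

End Cosines.

(** * Polynomials converging to a step function *)

Section StepPolynomials.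
Variable R : realType.
Implicit Types (x y r : R) (n m : nat).

Lemma bernoulli_ineq m x : -1 <= x -> 1 + m%:R * x <= (1 + x) ^+ m.
Proof.
move=> x1; have x0 : 0 <= 1 + x by lra.
elim: m => [|m IH]; first by rewrite mul0r addr0 expr0.
rewrite exprS; apply: le_trans (ler_wpM2l x0 IH).
have m0 : 0 <= m%:R :> R by [].
rewrite -natr1; have := sqr_ge0 x; move: (m%:R : R) m0 => M M0 xx.
have := mulr_ge0 M0 xx; lra.
Qed.

(** With [r = s^2], Bernoulli's inequality for [1 / s] bounds [n s^n], and the remaining factor
    [s^n] tends to [0]. *)
Lemma cvg_nexpn r : 0 <= r < 1 -> n%:R * r ^+ n @[n --> \oo] --> (0 : R).
Proof.
move=> /andP[r0 r1]; pose s := Num.sqrt r.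
have s0 : 0 <= s by exact: sqrtr_ge0.
have s1 : s < 1 by rewrite -sqrtr1 ltr_sqrt.
have sr : s ^+ 2 = r by exact: sqr_sqrtr.
have bd n : n%:R * s ^+ n <= (1 - s)^-1.
  rewrite -[leRHS]mul1r ler_pdivlMr ?subr_gt0//.
  have [->|sn0] := eqVneq s 0.
    by case: n => [|n]; rewrite ?mul0r// exprS mul0r mulr0 mul0r.
  have sp : 0 < s by rewrite lt_neqAle eq_sym sn0.
  have b2 : 1 + n%:R * (s^-1 - 1) <= (s ^+ n)^-1.
    have -> : (s ^+ n)^-1 = (1 + (s^-1 - 1)) ^+ n by rewrite [1 + _]addrC subrK exprVn.
    by apply: bernoulli_ineq; rewrite lerBrDr addNr invr_ge0.
  have sn : 0 < s ^+ n by exact: exprn_gt0.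
  move: b2; rewrite -(ler_pM2r sn) mulVf ?lt0r_neq0// => h.
  have : n%:R * (s^-1 - 1) * s ^+ n <= 1 by move: h sn; nra.
  have -> : n%:R * (s^-1 - 1) * s ^+ n = n%:R * s ^+ n * (1 - s) / s by field.
  rewrite ler_pdivrMr// mul1r => /le_trans; apply; exact: ltW.
have cs : (1 - s)^-1 * s ^+ n @[n --> \oo] --> (0 : R).
  rewrite -[X in _ --> X](mulr0 (1 - s)^-1); apply: cvgMr; apply: cvg_expr.
  by rewrite ger0_norm.
apply: (@squeeze_cvgr _ _ _ _ (fun=> 0) (fun n => (1 - s)^-1 * s ^+ n)) => //.
  apply: nearW => n; rewrite mulr_ge0 ?exprn_ge0//=.
  rewrite -sr exprAC expr2 mulrA ler_wpM2r// exprn_ge0//.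
exact: cvg_cst.
Qed.

(** By Bernoulli's inequality [step n y] lies between [1 - n (2 y)^n] and [1 / (1 + n (2 y)^n)].
    The factor [2^n] in the exponent places the jump at [y = 1 / 2], and the factor [n] makes the
    limit at [1 / 2] itself equal to [0]. *)
Definition step n y := (1 - y ^+ n) ^+ (n * 2 ^ n).

Lemma step_itv n y : 0 <= y <= 1 -> 0 <= step n y <= 1.
Proof.
move=> /andP[y0 y1]; have yn : 0 <= y ^+ n by exact: exprn_ge0.
have yn1 : y ^+ n <= 1 by exact: exprn_ile1.
by rewrite /step exprn_ge0 ?subr_ge0//= exprn_ile1 ?subr_ge0// gerBl.
Qed.

Lemma step_natE n y : (n * 2 ^ n)%:R * y ^+ n = n%:R * (2 * y) ^+ n.
Proof. by rewrite natrM natrX exprMn mulrA. Qed.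

Lemma step_cvg1 y : 0 <= y < 1 / 2 -> step n y @[n --> \oo] --> (1 : R).
Proof.
move=> /andP[y0 y2].
apply: (@squeeze_cvgr _ _ _ _ (fun n => 1 - n%:R * (2 * y) ^+ n) (fun=> 1)).
- apply: nearW => n; have /andP[_ ->] : 0 <= step n y <= 1.
    by apply: step_itv; rewrite y0; lra.
  rewrite andbT -step_natE -mulrN; apply: bernoulli_ineq.
  by rewrite lerN2 exprn_ile1//; lra.
- rewrite -[X in _ --> X]subr0; apply: cvgB; first exact: cvg_cst.
  by apply: cvg_nexpn; apply/andP; split; lra.
- exact: cvg_cst.
Qed.

Lemma step_cvg0 y : 1 / 2 <= y <= 1 -> step n y @[n --> \oo] --> (0 : R).
Proof.
move=> /andP[y2 y1]; have y0 : 0 <= y by lra.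
apply: (@squeeze_cvgr _ _ _ _ (fun=> 0) (fun n => n.+1%:R^-1)).
- apply: nearW => n; have /andP[-> _] : 0 <= step n y <= 1.
    by apply: step_itv; rewrite y0.
  have yn : 0 <= y ^+ n by exact: exprn_ge0.
  have yn1 : y ^+ n <= 1 by exact: exprn_ile1.
  apply: (@le_trans _ _ (((1 + y ^+ n) ^+ (n * 2 ^ n))^-1)).
    rewrite -exprVn /step; apply: lerXn2r; rewrite ?nnegrE ?subr_ge0//.
      by rewrite invr_ge0 addr_ge0.
    rewrite -[leRHS]mul1r ler_pdivlMr; last by rewrite ltr_wpDr.
    by move: (y ^+ n) yn => t t0; nra.
  rewrite lef_pV2 ?posrE ?exprn_gt0 ?ltr_wpDr//.
  apply: (le_trans _ (@bernoulli_ineq (n * 2 ^ n) (y ^+ n) _)); last by lra.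
  rewrite -nat1r lerD2l step_natE -[leLHS]mulr1 ler_wpM2l//.
  by rewrite exprn_ege1//; lra.
- exact: cvg_cst.
- exact: cvg_harmonic.
Qed.

End StepPolynomials.

(** * Quadrants generate the Borel sets of the plane *)

Section Generation.
Variable R : realType.

Definition quadrant (a b : R) : set (plane R) := [set z | z.1 < a /\ z.2 < b].

Definition quadrants : set (set (plane R)) :=
  [set A | exists a b, A = quadrant a b].

Lemma open_quadrant a b : open (quadrant a b : set (R * R)).
Proof.
rewrite (_ : quadrant a b = fst @^-1` [set x | x < a] `&` snd @^-1` [set x | x < b]) //.
by apply: openI; apply: open_comp => [z _|]; [exact: cvg_fst|exact: open_lt|
    exact: cvg_snd|exact: open_lt].
Qed.

(** Half-planes are increasing unions of quadrants, so both coordinates are measurable for the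
    sigma-algebra that the quadrants generate. *)
Lemma measurable_plane_quadrants : @measurable _ (plane R) = <<s quadrants >>.
Proof.
apply/seteqP; split; last first.
  apply: smallest_sub; first exact: sigma_algebra_measurable.
  by move=> _ [a [b ->]]; apply: open_measurable_plane; exact: open_quadrant.
have m1 : measurable_fun setT (fst : g_sigma_algebraType quadrants -> measurableTypeR R).
  apply: (measurability _ (measurable_realfun.RGenInftyO.measurableE R)).
  move=> _ [_ [a ->] <-]; rewrite setTI.
  rewrite (_ : _ @^-1` _ = \bigcup_n quadrant a n%:R).
    by apply: bigcup_measurable => n _; apply: sub_sigma_algebra; exists a, n%:R.
  apply/seteqP; split => [z /=|z [n _ [/= za _]]]; rewrite in_itv//= => za.
  exists (Num.bound (`|z.2| : R)) => //; split => //=.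
  by rewrite (le_lt_trans (ler_norm _)) ?archi_boundP.
have m2 : measurable_fun setT (snd : g_sigma_algebraType quadrants -> measurableTypeR R).
  apply: (measurability _ (measurable_realfun.RGenInftyO.measurableE R)).
  move=> _ [_ [a ->] <-]; rewrite setTI.
  rewrite (_ : _ @^-1` _ = \bigcup_n quadrant n%:R a).
    by apply: bigcup_measurable => n _; apply: sub_sigma_algebra; exists n%:R, a.
  apply/seteqP; split => [z /=|z [n _ [/= _ za]]]; rewrite in_itv//= => za.
  exists (Num.bound (`|z.1| : R)) => //; split => //=.
  by rewrite (le_lt_trans (ler_norm _)) ?archi_boundP.
move=> S mS; have := measurable_fun_pair m1 m2 measurableT mS.
rewrite setTI (_ : _ @^-1` S = S); first by apply.
by apply/seteqP; split=> -[x y].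
Qed.

End Generation.

(** * Completeness of the cosine products *)

Section Completeness.
Variable R : realType.
Implicit Types (f g : R * R -> R) (z : R * R) (P Q : {poly R}).

Local Notation mu2 := (lebesgue2 R).

Variables (L1 L2 : R) (u : R * R -> R).
Hypotheses (l1 : 0 < L1) (l2 : 0 < L2).
Local Notation Omega := (rect L1 L2).
Hypothesis iu : mu2.-integrable Omega (EFin \o u).

Let a : R := pi / L1.
Let c : R := pi / L2.

Hypothesis u_ortho : forall p q : nat,
  \int[mu2]_(z in Omega) (u z * coswave (p%:R * a) (q%:R * c) z) = 0.

Lemma open_rect : open Omega.
Proof.
rewrite (_ : Omega = fst @^-1` `]0, L1[ `&` snd @^-1` `]0, L2[).
  by apply: openI; apply: open_comp => [z _|]; [exact: cvg_fst|exact: interval_open|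
    exact: cvg_snd|exact: interval_open].
by apply/seteqP; split=> -[x y] /=; rewrite !in_itv.
Qed.

Let mO : measurable (Omega : set (plane R)).
Proof. exact: open_measurable_plane open_rect. Qed.

(** Continuity is included because it makes [u * f] integrable, which linearity of the
    integral requires. *)
Definition ortho f := continuous f /\ \int[mu2]_(z in Omega) (u z * f z) = 0.

Lemma integrable_mul_continuous f : continuous f ->
  mu2.-integrable Omega (EFin \o (fun z => u z * f z)).
Proof.
move=> cf; have [M M0 OM] := bounded_subset_square (rect_bounded L1 L2).
exact: integrableM_continuous mO OM cf iu.
Qed.

Lemma orthoD f g : ortho f -> ortho g -> ortho (fun z => f z + g z).
Proof.
move=> [cf f0] [cg g0]; split; first by move=> z; apply: cvgD; [exact: cf|exact: cg].
transitivity (\int[mu2]_(z in Omega) (u z * f z + u z * g z)).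
  by apply: eq_integral_on => z _; rewrite mulrDr.
rewrite (RintegralD mO (integrable_mul_continuous cf) (integrable_mul_continuous cg)).
by rewrite f0 g0 addr0.
Qed.

Lemma orthoZ k f : ortho f -> ortho (fun z => k * f z).
Proof.
move=> [cf f0]; split; first by move=> z; apply: cvgM; [exact: cvg_cst|exact: cf].
transitivity (\int[mu2]_(z in Omega) (k * (u z * f z))).
  by apply: eq_integral_on => z _; rewrite mulrCA.
rewrite (@RintegralZl _ _ _ mu2 Omega (fun z => u z * f z) k mO) ?f0 ?mulr0//.
exact: integrable_mul_continuous.
Qed.

Let X z := cos (a * z.1).
Let Y z := cos (c * z.2).

Lemma cos_step (b t : R) (n : nat) : cos (b * t) * cos (n.+1%:R * b * t) =
  2^-1 * cos (n.+2%:R * b * t) + 2^-1 * cos (n%:R * b * t).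
Proof.
rewrite -!mulrA; move: (b * t) => {}t.
have -> : n.+2%:R * t = n.+1%:R * t + t by rewrite -natr1 mulrDl mul1r.
have -> : n%:R * t = n.+1%:R * t - t by rewrite -[n.+1%:R]natr1 mulrDl mul1r addrK.
by rewrite cosD cosB; field.
Qed.

(** A further factor [cos (c y)] turns a frequency [q] into the half-sum of the frequencies
    [q + 1] and [q - 1], by [cos_step]; for [q = 0] it is itself the frequency [1]. *)
Lemma ortho_expY j (p q : nat) :
  ortho (fun z => cos (p%:R * a * z.1) * (Y z ^+ j * cos (q%:R * c * z.2))).
Proof.
elim: j q => [|j IH] q.
  under eq_fun do rewrite expr0 mul1r.
  by split; [exact: smooth_continuous (smooth_coswave _ _)|exact: u_ortho].
case: q => [|q].
  have := IH 1%N; congr ortho; apply/funext => z.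
  by rewrite !mul0r cos0 mulr1 exprSr mul1r.
have := orthoD (orthoZ 2^-1 (IH q.+2)) (orthoZ 2^-1 (IH q)).
congr ortho; apply/funext => z.
by rewrite exprSr -(mulrA (Y z ^+ j) (Y z)) cos_step; ring.
Qed.

Lemma ortho_expXY i j (p q : nat) :
  ortho (fun z => X z ^+ i * cos (p%:R * a * z.1) * (Y z ^+ j * cos (q%:R * c * z.2))).
Proof.
elim: i p => [|i IH] p.
  by under eq_fun do rewrite expr0 mul1r; exact: ortho_expY.
case: p => [|p].
  have := IH 1%N; congr ortho; apply/funext => z.
  by rewrite !mul0r cos0 mulr1 exprSr mul1r.
have := orthoD (orthoZ 2^-1 (IH p.+2)) (orthoZ 2^-1 (IH p)).
congr ortho; apply/funext => z.
by rewrite exprSr -(mulrA (X z ^+ i) (X z)) cos_step; ring.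
Qed.

Lemma ortho_exp i j : ortho (fun z => X z ^+ i * Y z ^+ j).
Proof.
have := ortho_expXY i j 0 0; congr ortho; apply/funext => z.
by rewrite !mul0r cos0 !mulr1.
Qed.

(** The weight [w] lets the passage from monomials to polynomials be made in one variable at
    a time. *)
Lemma ortho_horner (w Z : R * R -> R) : (forall i, ortho (fun z => w z * Z z ^+ i)) ->
  forall P, ortho (fun z => w z * P.[Z z]).
Proof.
move=> H P; suff HP i : ortho (fun z => w z * (P.[Z z] * Z z ^+ i)).
  by have := HP 0%N; congr ortho; apply/funext => z; rewrite expr0 mulr1.
elim/poly_ind: P i => [|P k IH] i.
  have := orthoZ 0 (H 0%N); congr ortho; apply/funext => z.
  by rewrite horner0 !mul0r mulr0.
have := orthoD (IH i.+1) (orthoZ k (H i)); congr ortho; apply/funext => z.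
by rewrite hornerMXaddC (exprS (Z z) i); ring.
Qed.

Lemma ortho_poly P Q : ortho (fun z => P.[X z] * Q.[Y z]).
Proof.
have H i : ortho (fun z => Q.[Y z] * X z ^+ i).
  have := @ortho_horner (fun z => X z ^+ i) Y (ortho_exp i) Q.
  by congr ortho; apply/funext => z; rewrite mulrC.
have := ortho_horner H P.
by congr ortho; apply/funext => z; rewrite mulrC.
Qed.

(** [step n] composed with the affine map that sends [s] to [1 / 2] and [[-1, 1]] into
    [[0, 1]] whenever [s] lies in [[-1, 1]]. *)
Definition step_poly (s : R) n : {poly R} :=
  (1 - ((1 / 2)%:P + (1 / 4)%:P * (s%:P - 'X)) ^+ n) ^+ (n * 2 ^ n).

Lemma horner_step_poly s n x :
  (step_poly s n).[x] = step n (1 / 2 + 1 / 4 * (s - x)).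
Proof. by rewrite /step_poly /step !hornerE. Qed.

Lemma step_arg (s x : R) : -1 <= s <= 1 -> -1 <= x <= 1 ->
  0 <= 1 / 2 + 1 / 4 * (s - x) <= 1.
Proof. by move=> /andP[? ?] /andP[? ?]; apply/andP; split; lra. Qed.

Lemma cos_itv (x : R) : -1 <= cos x <= 1.
Proof. by rewrite cos_geN1 cos_le1. Qed.

(** The cosine decreases on [[0, pi]], so [t < s] holds exactly when
    [cos (pi / L * s) < cos (pi / L * t)], that is when the argument of [step] is below [1 / 2]. *)
Lemma step_poly_cvg (L t s : R) : 0 < t < L -> 0 < s <= L ->
  (step_poly (cos (pi / L * s)) n).[cos (pi / L * t)] @[n --> \oo] -->
    ((t < s)%R%:R : R).
Proof.
move=> /andP[t0 tL] /andP[s0 sL]; have L0 := lt_trans t0 tL.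
under eq_fun do rewrite horner_step_poly.
have := step_arg (cos_itv (pi / L * s)) (cos_itv (pi / L * t)).
have inpi x : 0 < x <= L -> pi / L * x \in `[0, pi].
  move=> /andP[x0 xL]; rewrite in_itv/=; apply/andP; split.
    by rewrite mulr_ge0 ?divr_ge0 ?pi_ge0 ?ltW.
  rewrite mulrAC -mulrA ler_piMr ?pi_ge0//.
  by rewrite ler_pdivrMr// mul1r.
have pL : 0 < pi / L :> R by rewrite divr_gt0// pi_gt0.
have := ltr_cos (inpi t _) (inpi s _); rewrite s0 sL t0 (ltW tL) => /(_ isT isT) E.
have E2 : (cos (pi / L * s) < cos (pi / L * t)) = (t < s) by rewrite E ltr_pM2l.
move=> /andP[h0 h1]; have [ts|ts] := ltP t s.
- apply: step_cvg1; rewrite h0/=; have := ts; rewrite -E2; lra.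
- apply: step_cvg0; rewrite h1 andbT.
  have : ~~ (cos (pi / L * s) < cos (pi / L * t)) by rewrite E2 -leNgt.
  rewrite -leNgt; lra.
Qed.

Lemma integral_quadrant_pos s t : 0 < s <= L1 -> 0 < t <= L2 ->
  \int[mu2]_(z in Omega) (u z * ((z.1 < s)%R%:R * (z.2 < t)%R%:R)) = 0.
Proof.
move=> sL tL.
pose F n z := (step_poly (cos (a * s)) n).[X z] * (step_poly (cos (c * t)) n).[Y z].
have cF n : \int[mu2]_(z in Omega) (u z * F n z) = 0.
  by have [] := ortho_poly (step_poly (cos (a * s)) n) (step_poly (cos (c * t)) n).
have F01 n z : 0 <= F n z <= 1.
  rewrite /F !horner_step_poly.
  have /andP[A0 A1] := step_itv n (step_arg (cos_itv (a * s)) (cos_itv (a * z.1))).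
  have /andP[B0 B1] := step_itv n (step_arg (cos_itv (c * t)) (cos_itv (c * z.2))).
  by rewrite mulr_ge0//= mulr_ile1.
pose G z : R := (z.1 < s)%R%:R * (z.2 < t)%R%:R.
have iF n : mu2.-integrable Omega (EFin \o (fun z => u z * F n z)).
  apply: integrable_mul_continuous.
  by have [] := ortho_poly (step_poly (cos (a * s)) n) (step_poly (cos (c * t)) n).
have GE : G = \1_(quadrant s t).
  apply/funext => z; rewrite /G indicE -natrM mulnb.
  have -> // : (z \in quadrant s t) = (z.1 < s) && (z.2 < t).
  by apply/idP/andP => [|[zs zt]]; rewrite inE.
have iG : mu2.-integrable Omega (EFin \o (fun z => u z * G z)).
  have -> : EFin \o (fun z => u z * G z) = ((EFin \o u) \* (EFin \o G))%E.
    by apply/funext => z /=; rewrite EFinM.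
  apply: integrableMl => //.
  - rewrite GE; apply: measurable_indic; apply: open_measurable_plane.
    exact: open_quadrant.
  - exists 1; split; first exact: num_real.
    move=> x x1 z _ /=; rewrite GE indicE; apply: le_trans (ltW x1).
    by case: (z \in _); rewrite ?normr1 ?normr0.
have cv : \int[mu2]_(z in Omega) (u z * F n z) @[n --> \oo] -->
    \int[mu2]_(z in Omega) (u z * G z).
  apply: (@Rintegral_dominated_cvg _ _ _ _ (fun z => `|u z|) mO iF iG).
  - exact: integrable_norm.
  - move=> z [z1 z2]; apply: cvgMr; apply: cvgM; exact: step_poly_cvg.
  - move=> n z _; have /andP[F0 F1] := F01 n z.
    by rewrite normrM (ger0_norm F0) ler_piMr.
have cv0 : \int[mu2]_(z in Omega) (u z * F n z) @[n --> \oo] --> (0 : R).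
  by rewrite (_ : (fun n => _) = (fun=> 0)); [exact: cvg_cst|apply/funext => n; exact: cF].
exact: (cvg_unique (@Rhausdorff R) cv cv0).
Qed.

Lemma integral_quadrant s t : \int[mu2]_(z in Omega `&` quadrant s t) u z = 0.
Proof.
have [s0|s0] := leP s 0.
  rewrite (_ : _ `&` _ = set0) ?Rintegral_set0//.
  by rewrite -subset0 => z [[/andP[z1 _] _] [/(lt_trans z1) + _]]; rewrite ltNge s0.
have [t0|t0] := leP t 0.
  rewrite (_ : _ `&` _ = set0) ?Rintegral_set0//.
  by rewrite -subset0 => z [[_ /andP[z1 _]] [_ /(lt_trans z1)]]; rewrite ltNge t0.
have H := @integral_quadrant_pos (Num.min s L1) (Num.min t L2).
rewrite -[RHS]H; last 2 first.
- by rewrite lt_min s0 l1 ge_min lexx orbT.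
- by rewrite lt_min t0 l2 ge_min lexx orbT.
rewrite Rintegral_mkcondr; apply: eq_integral_on => z [/andP[z1 z1L] /andP[z2 z2L]].
rewrite patchE; case: ifPn.
  by rewrite inE => -[zs zt]; rewrite !lt_min zs zt z1L z2L !mulr1.
rewrite notin_setE /quadrant/= => Nq.
have [zs|zs] := boolP (z.1 < s); last by rewrite lt_min (negbTE zs)/= mul0r mulr0.
have [zt|zt] := boolP (z.2 < t); last by rewrite (lt_min _ t) (negbTE zt)/= !mulr0.
by exfalso; apply: Nq.
Qed.

(** Quadrants are stable under intersection, so the sets over which [u] has integral [0] contain
    the sigma-algebra that they generate, by Dynkin's pi-lambda argument. *)
Lemma integral_measurable0 (E : set (plane R)) : measurable E ->
  (\int[mu2]_(z in Omega `&` E) (u z)%:E = 0)%E.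
Proof.
have iE (S : set (plane R)) : measurable S -> mu2.-integrable (Omega `&` S) (EFin \o u).
  by move=> mS; apply: integrableS iu => //; exact: measurableI.
have R0 (S : set (plane R)) : measurable S -> \int[mu2]_(z in Omega `&` S) u z = 0 ->
    (\int[mu2]_(z in Omega `&` S) (u z)%:E = 0)%E.
  move=> mS S0; rewrite -[LHS]fineK; first by rewrite [fine _]S0.
  by apply: integrable_fin_num; [exact: measurableI|exact: iE].
have OT : (\int[mu2]_(z in Omega `&` setT) (u z)%:E = 0)%E.
  apply: R0 => //; rewrite -[RHS](integral_quadrant L1 L2).
  congr Rintegral; apply/seteqP; split => z [Oz _]; split => //.
  by case: Oz => /andP[_ ?] /andP[_ ?].
rewrite measurable_plane_quadrants; move: E.
apply: (dynkin_induction (measurable_plane_quadrants R)) => //.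
- move=> _ _ [s [t ->]] [s' [t' ->]]; exists (Num.min s s'), (Num.min t t').
  apply/seteqP; split => z /=; rewrite /quadrant/= !lt_min.
    by move=> [[-> ->] [-> ->]].
  by move=> [/andP[-> ->] /andP[-> ->]].
- move=> _ [s [t ->]]; apply: R0; last exact: integral_quadrant.
  by apply: open_measurable_plane; exact: open_quadrant.
- move=> S mS S0.
  have := @integral_setU_EFin _ _ _ mu2 (Omega `&` S) (Omega `&` ~` S) u.
  rewrite -setIUr setUCr OT S0 add0e => -> //.
  + exact: measurableI.
  + by apply: measurableI => //; exact: measurableC.
  + by apply/measurable_EFinP; apply: (measurable_int mu2); exact: iE.
  + by apply/disj_setPS => z [[_ Sz] [_]].
- move=> F mF tF F0; rewrite setI_bigcupr.
  rewrite integral_bigcup.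
  + by apply: eseries0 => n _ _; exact: F0.
  + by apply: trivIset_setIl.
  + by move=> k; apply: measurableI.
  + by rewrite -setI_bigcupr; apply: iE; exact: bigcup_measurable.
Qed.

Lemma cosines_complete : {ae mu2, forall z, Omega z -> u z = 0}.
Proof.
have : ae_eq mu2 Omega (EFin \o u) (cst 0%E).
  apply: integral_ae_eq => // E EO mE.
  by rewrite integral0 -(integral_measurable0 mE) (setIidr EO).
by apply: filterS => z /= H Oz; have [] := H Oz.
Qed.

End Completeness.

(** * Lower bound for the eigenvalues of a rectangle *)

Section RectangleEigenvalue.
Variable R : realType.
Implicit Types (f g u : R * R -> R) (z : R * R).

Local Notation mu2 := (lebesgue2 R).

Lemma integrable_sum_on (Omega : set (R * R)) (I : Type) (r : seq I)
    (F : I -> R * R -> R) : measurable (Omega : set (plane R)) ->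
  (forall i, mu2.-integrable Omega (EFin \o F i)) ->
  mu2.-integrable Omega (EFin \o (fun z => \sum_(i <- r) F i z)) /\
  \int[mu2]_(z in Omega) (\sum_(i <- r) F i z) =
  \sum_(i <- r) \int[mu2]_(z in Omega) F i z.
Proof.
move=> mO iF; elim: r => [|i r [IH1 IH2]].
  split.
    rewrite (_ : EFin \o _ = cst 0%E); first exact: integrable0.
    by apply/funext => z /=; rewrite big_nil.
  rewrite big_nil -[RHS](mul0r (fine (mu2 Omega))) -(Rintegral_cst mu2 mO 0).
  by apply: eq_integral_on => z _; rewrite big_nil.
split.
  apply: eq_integrable (integrableD mO (iF i) IH1) => //.
  by move=> z _; rewrite /= big_cons EFinD.
transitivity (\int[mu2]_(z in Omega) (F i z + \sum_(i <- r) F i z)).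
  by apply: eq_integral_on => z _; rewrite big_cons.
by rewrite (RintegralD mO (iF i) IH1) IH2 big_cons.
Qed.

Variable k : nat.
Hypothesis k_gt0 : (0 < k)%N.

Let h : R := k%:R^-1.
Let h_gt0 : 0 < h. Proof. by rewrite invr_gt0 ltr0n. Qed.
Local Notation Omega := (rect 1 h).

Let mO : measurable (Omega : set (plane R)).
Proof. by apply: open_measurable_plane; exact: open_rect. Qed.

Let a : R := pi / 1.
Let c : R := pi / h.

Let wave (p q : nat) := coswave (p%:R * a) (q%:R * c).
Let level (p q : nat) : R := (p%:R * a) ^+ 2 + (q%:R * c) ^+ 2.

Lemma sin_natpi n : sin (n%:R * pi) = 0 :> R.
Proof.
elim: n => [|n IH]; first by rewrite mul0r sin0.
by rewrite -natr1 mulrDl mul1r sinD IH sinpi mul0r mulr0 addr0.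
Qed.

Lemma wave_eigen p q : neumann_eigenspace Omega (level p q) (wave p q).
Proof.
apply: coswave_eigen => //.
- by rewrite /a divr1 mulr1 sin_natpi.
- by rewrite /c -mulrA divfK ?sin_natpi// lt0r_neq0.
Qed.

Lemma low_level p q : level p q < (k%:R * pi) ^+ 2 -> q = 0%N /\ (p < k)%N.
Proof.
have pi2 : 0 < (pi : R) ^+ 2 by rewrite exprn_gt0// pi_gt0.
rewrite /level /a /c divr1 invrK !exprMn -!natrX.
rewrite (_ : (p ^ 2)%:R * pi ^+ 2 + _ = (p ^ 2 + q ^ 2 * k ^ 2)%:R * pi ^+ 2); last first.
  by rewrite natrD natrM !natrX; ring.
rewrite ltr_pM2r// ltr_nat => lt; split.
  case: q lt => // q; rewrite ltnNge => /negP[].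
  by rewrite (leq_trans _ (leq_addl _ _))// leq_pmull// expn_gt0.
rewrite -(@ltn_exp2r p k 2)//; exact: leq_ltn_trans (leq_addr _ _) lt.
Qed.

Lemma level_inj p p' : level p 0 = level p' 0 -> p = p'.
Proof.
have pi0 : 0 < (pi : R) by exact: pi_gt0.
rewrite /level /a !mul0r expr0n/= !addr0 divr1 => /eqP.
rewrite eqrXn2// ?mulr_ge0// ?ltW// => /eqP/(mulIf (lt0r_neq0 pi0))/eqP.
by rewrite eqr_nat => /eqP.
Qed.

(** An eigenfunction for [lam] is orthogonal to every wave whose level is not [lam], and below
    [(k pi)^2] at most one wave has the level [lam]. A combination of eigenfunctions orthogonal to
    that wave vanishes by completeness. Hence there is no eigenfunction when [lam] is no level, and
    no two independent ones when it is. *)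
Lemma low_multiplicity lam m : lam < (k%:R * pi) ^+ 2 -> (0 < m)%N ->
  multiplicity_ge Omega lam m ->
  (m <= 1)%N /\ exists2 p, (p < k)%N & lam = level p 0.
Proof.
move=> lamk m0 [u [eu indep]].
have iu i : mu2.-integrable Omega (EFin \o u i).
  have [g1 [g2 [[su _ _ _] _]]] := eu i.
  have [M _ OM] := bounded_subset_square (rect_bounded 1 h).
  exact: square_integrable_integrable mO OM su.
pose coef i p q := \int[mu2]_(z in Omega) (u i z * wave p q z).
have coef0 i p q : lam != level p q -> coef i p q = 0.
  exact: eigen_orthogonal (eu i) (wave_eigen p q).
have cw p q : continuous (wave p q).
  exact: smooth_continuous (smooth_coswave _ _).
have iZ (d : R) f : mu2.-integrable Omega (EFin \o f) ->
    mu2.-integrable Omega (EFin \o (fun z => d * f z)).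
  move=> i_f; apply: eq_integrable (integrableZl mO d i_f) => //.
have key (d : 'I_m -> R) : (forall p q, \sum_i d i * coef i p q = 0) ->
    forall i, d i = 0.
  move=> d0; apply: indep.
  have [iw _] := integrable_sum_on (index_enum _) mO (fun i => iZ (d i) _ (iu i)).
  apply: (cosines_complete ltr01 h_gt0 iw) => p q.
  rewrite -[RHS](d0 p q).
  have iF i : mu2.-integrable Omega (EFin \o (fun z => d i * (u i z * wave p q z))).
    apply: iZ; exact: integrable_mul_continuous (iu i) _ (cw p q).
  have [_ sumE] := integrable_sum_on (index_enum _) mO iF.
  transitivity (\int[mu2]_(z in Omega) (\sum_i d i * (u i z * wave p q z))).
    apply: eq_integral_on => z _; rewrite mulr_suml; apply: eq_bigr => i _.
    exact: (esym (mulrA _ _ _)).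
  rewrite sumE; apply: eq_bigr => i _.
  by rewrite (@RintegralZl _ _ _ mu2 Omega (fun z => u i z * wave p q z) (d i) mO
    (integrable_mul_continuous (iu i) (cw p q))).
have [p0 p0k lamE] : exists2 p, (p < k)%N & lam = level p 0.
  apply: contrapT => Np.
  suff E1 p q : \sum_i 1 * coef i p q = 0.
    by have /eqP := key (fun=> 1) E1 (Ordinal m0); rewrite oner_eq0.
  apply: big1 => i _; rewrite coef0 ?mulr0//.
  apply/eqP => E; have := lamk; rewrite E => /low_level[q0 pk].
  by apply: Np; exists p => //; rewrite E q0.
split; last by exists p0.
have coefE i p q : (p, q) != (p0, 0%N) -> coef i p q = 0.
  move=> pq; apply: coef0; apply: contraNneq pq => E.
  have := lamk; rewrite E => /low_level[q0 _].
  by move: E; rewrite q0 lamE => /level_inj ->.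
rewrite leqNgt; apply/negP => m1.
pose i0 := Ordinal m0; pose i1 := Ordinal m1.
have i01 : i1 != i0 by [].
(* The combination of [u i0] and [u i1] that is orthogonal to the wave of level [lam]. *)
pose d i := if i == i0 then coef i1 p0 0%N else if i == i1 then - coef i0 p0 0%N else 0.
have d_sum p q : \sum_i d i * coef i p q = 0.
  have [[-> ->]|pq] := eqVneq (p, q) (p0, 0%N); last first.
    by apply: big1 => i _; rewrite coefE// mulr0.
  rewrite (bigD1 i0)//= (bigD1 i1)//= big1 ?addr0.
    by rewrite /d eqxx (negbTE i01) eqxx; ring.
  by move=> i /andP[ni0 ni1]; rewrite /d (negbTE ni0) (negbTE ni1) mul0r.
have c0 : coef i0 p0 0%N = 0.
  have := key _ d_sum i1; rewrite /d (negbTE i01) eqxx => /eqP.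
  by rewrite oppr_eq0 => /eqP.
suff E1 p q : \sum_i (i == i0)%:R * coef i p q = 0.
  have := key (fun i => (i == i0)%:R) E1 i0.
  by rewrite eqxx => /eqP; rewrite oner_eq0.
rewrite (bigD1 i0)//= big1 ?addr0; last by move=> i /negbTE ->; rewrite mul0r.
rewrite mul1r; have [[-> ->]//|pq] := eqVneq (p, q) (p0, 0%N).
exact: coefE.
Qed.

(** If [mu_k] were smaller, [k + 1] eigenvalues below [(k pi)^2] would be pairwise distinct,
    being simple, and would inject into the [k] levels [p < k], [q = 0]. *)
Lemma rect_eigenvalue_ge : (((k%:R * pi) ^+ 2)%:E <= neumann_eigenvalue Omega k)%E.
Proof.
apply: le_ereal_inf_tmp => _ [t [l [lt mult]] <-]; rewrite lee_fin leNgt; apply/negP => tk.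
have H i : (#|[pred j | l j == l i]| <= 1)%N /\ exists2 p, (p < k)%N & l i = level p 0.
  apply: low_multiplicity (mult (l i)); first exact: le_lt_trans (lt i) tk.
  by apply/card_gt0P; exists i; rewrite inE.
have linj : injective l.
  move=> i j lij; have [/card_le1_eqP H1 _] := H j.
  by apply: H1; rewrite inE ?lij.
have /choice[P PE] : forall i, exists p : 'I_k, l i = level p 0.
  by move=> i; have [_ [p pk ->]] := H i; exists (Ordinal pk).
have Pinj : injective P by move=> i j Pij; apply: linj; rewrite !PE Pij.
by have := leq_card P Pinj; rewrite !card_ord ltnn.
Qed.

End RectangleEigenvalue.

(** * Upper bound for the perimeter of a disk *)

Section Perimeter.
Variable R : realType.
Implicit Types (z w : R * R) (A : set (R * R)) (d r : R).

Lemma euclid_dist_le_sqr z w d : 0 <= d ->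
  (euclid_dist z w <= d) = ((z.1 - w.1) ^+ 2 + (z.2 - w.2) ^+ 2 <= d ^+ 2).
Proof.
by move=> d0; rewrite /euclid_dist -{1}(ger0_norm d0) -sqrtr_sqr ler_sqrt// sqr_ge0.
Qed.

Lemma euclid_diam_ge0 A : (0 <= euclid_diam A)%E.
Proof. by apply: ereal_sup_ubound; left. Qed.

Lemma euclid_diam_set0 : euclid_diam (@set0 (R * R)) = 0%E.
Proof.
apply/eqP; rewrite eq_le euclid_diam_ge0 andbT.
by apply: ge_ereal_sup => _ [->//|[p [[]]]].
Qed.

Lemma euclid_diam_le A d : 0 <= d ->
  (forall z w, A z -> A w -> euclid_dist z w <= d) -> (euclid_diam A <= d%:E)%E.
Proof.
move=> d0 H; apply: ge_ereal_sup => _ [->|[p [Ap1 Ap2] <-]]; first by rewrite lee_fin.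
by rewrite lee_fin; exact: H.
Qed.

Lemma euclid_dist_le_diam A z w : A z -> A w ->
  ((euclid_dist z w)%:E <= euclid_diam A)%E.
Proof. by move=> Az Aw; apply: ereal_sup_ubound; right; exists (z, w). Qed.

Section Disk.
Variables (c : R * R) (r : R).
Hypothesis r_gt0 : 0 < r.

(** The polynomial [r^2 - |z - c|^2] defines the disk by a smooth inequality; the Euclidean
    distance is not smooth at the centre. *)
Definition disk_rho z : R := r ^+ 2 - ((z.1 - c.1) ^+ 2 + (z.2 - c.2) ^+ 2).

Lemma diskE : disk c r = [set z | 0 < disk_rho z].
Proof.
apply/seteqP; split=> z; rewrite /disk/disk_rho/= /euclid_dist subr_gt0
  -(sqrrN (z.1 - _)) -(sqrrN (z.2 - _)) !opprB => h.
- rewrite -(ger0_norm (ltW r_gt0)) -sqrtr_sqr ltr_sqrt ?exprn_gt0// in h.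
- by rewrite -[ltRHS](ger0_norm (ltW r_gt0)) -sqrtr_sqr ltr_sqrt ?exprn_gt0.
Qed.

Lemma smooth_disk_rho : smooth disk_rho.
Proof.
apply: smoothD; first exact: smooth_cst.
apply: smooth_opp; apply: smoothD.
- have sx : smooth (fun z => z.1 - c.1).
    by apply: smoothD; [exact: smooth_fst|exact: smooth_cst].
  exact: (smoothM sx sx).
- have sy : smooth (fun z => z.2 - c.2).
    by apply: smoothD; [exact: smooth_snd|exact: smooth_cst].
  exact: (smoothM sy sy).
Qed.

Lemma open_disk : open (disk c r).
Proof.
rewrite diskE; apply: (@open_comp _ _ disk_rho [set x | 0 < x]) => [z _|]; last exact: open_gt.
exact: smooth_continuous smooth_disk_rho z.
Qed.

Definition circle_pt (t : R) : R * R := (c.1 + r * cos t, c.2 + r * sin t).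

Lemma circle_param (x y : R) : x ^+ 2 + y ^+ 2 = 1 ->
  exists2 t, 0 <= t <= 2 * pi & x = cos t /\ y = sin t.
Proof.
move=> xy1; have x1 : -1 <= x <= 1.
  rewrite -ler_norml -(ler_pXn2r (ltn0Sn 1)) ?nnegrE// expr1n real_normK ?num_real//.
  by rewrite -xy1 lerDl sqr_ge0.
have cx : cos (acos x) = x by apply: acosK; rewrite in_itv.
have sx : sin (acos x) = `|y|.
  by rewrite sin_acos// -sqrtr_sqr; congr Num.sqrt; rewrite -xy1; ring.
have p0 : 0 <= (pi : R) by exact: pi_ge0.
have a0 := acos_ge0 x1; have a1 := acos_lepi x1.
have [y0|y0] := leP 0 y.
- by exists (acos x); [apply/andP; split; lra|rewrite cx sx ger0_norm].
- exists (pi *+ 2 - acos x); first by rewrite mulr2n; apply/andP; split; lra.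
  rewrite addrC cosD2pi sinD2pi cosN sinN cx sx ltr0_norm// opprK.
  by split.
Qed.

Lemma boundary_disk : closure (disk c r) `\` interior (disk c r) `<=`
  [set circle_pt t | t in [set t : R | 0 <= t <= 2 * pi]].
Proof.
move=> z [cz]; rewrite ((interior_id (disk c r)).1 open_disk) => Nz.
have {}cz : 0 <= disk_rho z.
  have : closure (disk c r) `<=` [set z | 0 <= disk_rho z].
    rewrite [X in _ `<=` X](closure_id _).1; last first.
      apply: (@closed_comp _ _ disk_rho [set x | 0 <= x]) => [w _|]; last exact: closed_ge.
      exact: smooth_continuous smooth_disk_rho w.
    by apply: closureS => w; rewrite diskE /= => /ltW.
  by move=> /(_ z cz).
have rho0 : disk_rho z = 0.
  by apply/eqP; rewrite eq_le cz andbT leNgt; apply/negP => h; apply: Nz; rewrite diskE.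
have rn0 := lt0r_neq0 r_gt0.
have [|t t2 [xt yt]] := @circle_param ((z.1 - c.1) / r) ((z.2 - c.2) / r).
  rewrite !expr_div_n -mulrDl; move: rho0; rewrite /disk_rho => /eqP.
  by rewrite subr_eq0 => /eqP <-; rewrite divff// expf_neq0.
exists t => //; rewrite /circle_pt -xt -yt; case: z {cz Nz rho0 xt yt} => x y /=.
by congr pair; field.
Qed.

(** A chord is shorter than its arc: [|e^(is) - e^(it)|^2 = 4 (sin ((s - t) / 2))^2]. *)
Lemma circle_pt_dist s t : euclid_dist (circle_pt s) (circle_pt t) <= r * `|s - t|.
Proof.
have r0 := ltW r_gt0.
rewrite euclid_dist_le_sqr ?mulr_ge0//= exprMn real_normK ?num_real//.
have -> : (c.1 + r * cos s - (c.1 + r * cos t)) ^+ 2 + (c.2 + r * sin s - (c.2 + r * sin t)) ^+ 2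
  = r ^+ 2 * (cos s ^+ 2 + sin s ^+ 2 + (cos t ^+ 2 + sin t ^+ 2) - 2 * cos (s - t)).
  by rewrite cosB; ring.
rewrite !cos2Dsin2 ler_wpM2l ?sqr_ge0//.
have {1}-> : s - t = ((s - t) / 2) *+ 2 by rewrite -mulr_natr divfK.
rewrite cos_mulr2n cos2sin2.
have sl : sin ((s - t) / 2) ^+ 2 <= ((s - t) / 2) ^+ 2.
  rewrite -[leLHS]real_normK ?num_real// -[leRHS]real_normK ?num_real//.
  by apply: lerXn2r; rewrite ?nnegrE//; exact: norm_sin_le.
have E : ((s - t) / 2) ^+ 2 = (s - t) ^+ 2 / 4 by field.
move: sl; rewrite E mulr2n; move: (sin _ ^+ 2) ((s - t) ^+ 2) => S D; lra.
Qed.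

(** The circle is covered by [N] arcs of equal length at most [delta], and the diameter of an
    arc is at most its length. *)
Lemma perimeter_disk_le : (perimeter (disk c r) <= (2 * pi * r)%:E)%E.
Proof.
apply: ge_ereal_sup => _ [delta /= d0 <-].
have L0 : 0 <= 2 * pi * r :> R by rewrite !mulr_ge0 ?pi_ge0// ltW.
pose N := (Num.bound (2 * pi * r / delta)).+1.
have N0 : 0 < N%:R :> R by rewrite ltr0n.
have Nd : 2 * pi * r / N%:R <= delta.
  rewrite ler_pdivrMr// [leRHS]mulrC -ler_pdivrMr//.
  have := archi_boundP (divr_ge0 L0 (ltW d0)) => /ltW/le_trans; apply.
  by rewrite ler_nat.
set e := 2 * pi * r / N%:R in Nd.
have e0 : 0 <= e by rewrite divr_ge0.
pose U (i : nat) : set (R * R) := if (i < N)%N then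
  [set circle_pt t | t in [set t : R | i%:R * (2 * pi / N%:R) <= t <= i.+1%:R * (2 * pi / N%:R)]]
  else set0.
have dU i : (euclid_diam (U i) <= (if (i < N)%N then e else 0)%:E)%E.
  rewrite /U; case: ifP => iN; last by rewrite euclid_diam_set0.
  apply: euclid_diam_le => // _ _ [s /andP[s1 s2] <-] [t /andP[t1 t2] <-].
  apply: (le_trans (circle_pt_dist s t)).
  have -> : e = r * (2 * pi / N%:R) by rewrite /e; ring.
  rewrite ler_wpM2l ?(ltW r_gt0)//; move: s1 s2 t1 t2; rewrite -natr1 mulrDl mul1r.
  move: (i%:R * (2 * pi / N%:R) : R) (2 * pi / N%:R : R) => a b ? ? ? ?.
  by rewrite ler_norml; apply/andP; split; lra.
apply: ge_ereal_inf; exists (\sum_(0 <= i <oo) euclid_diam (U i))%E.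
  exists U => //; split; last first.
    by move=> i; apply: le_trans (dU i) _; rewrite lee_fin; case: ifP => // _; exact: ltW.
  move=> z /boundary_disk[t /= /andP[t0 t2] <-].
  have p0 : 0 < 2 * pi / N%:R :> R by rewrite !mulr_gt0 ?pi_gt0 ?invr_gt0.
  pose i := Num.truncn (t / (2 * pi / N%:R)).
  have [i1 i2] : i%:R * (2 * pi / N%:R) <= t /\ t < i.+1%:R * (2 * pi / N%:R).
    have /andP[a b] := truncn_itv (divr_ge0 t0 (ltW p0)).
    by rewrite -ler_pdivlMr// -ltr_pdivrMr.
  have [iN|Ni] := ltnP i N.
    by exists i => //; rewrite /U iN; exists t => //=; rewrite i1 ltW.
  (* Only the end point [2 pi] of the parametrization falls outside; it closes the last arc. *)
  have tE : t = N%:R * (2 * pi / N%:R).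
    apply/eqP; rewrite eq_le; apply/andP; split; first by rewrite mulrC divfK// lt0r_neq0.
    by apply: le_trans i1; rewrite ler_wpM2r ?ler_nat// ltW.
  exists N.-1 => //; rewrite /U /= ltnSn; exists t => //=; rewrite tE lexx andbT.
  by rewrite ler_wpM2r ?ler_nat// ltW.
apply: lime_le; first by apply: is_cvg_nneseries => i _ _; exact: euclid_diam_ge0.
apply: nearW => n.
apply: (@le_trans _ _ ((minn n N)%:R * e)%:E); last first.
  rewrite lee_fin (@le_trans _ _ (N%:R * e))//.
    by rewrite ler_wpM2r// ler_nat geq_minr.
  by rewrite /e mulrC divfK// lt0r_neq0.
elim: n => [|n IH]; first by rewrite big_geq// min0n mul0r.
rewrite big_nat_recr//=; apply: (le_trans (leeD IH (dU n))).
rewrite -EFinD lee_fin; case: ltnP => nN.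
  by rewrite (minn_idPl nN) -natr1 mulrDl mul1r.
by rewrite addr0 (minn_idPr (leqW nN)).
Qed.

End Disk.

End Perimeter.

(** * Lower bound for the perimeter of a rectangle *)

Section RectPerimeter.
Variable R : realType.
Implicit Types (z w : R * R) (A : set (R * R)) (d : R).

Local Notation mu := (@lebesgue_measure R).

(** Each nonempty [T i] lies between its infimum and its supremum, at distance at most [d i]
    from each other, and Lebesgue measure is countably subadditive. Empty [T i] are not
    counted, so that one cover can later be shared among several sides. *)
Lemma interval_cover_le (a b : R) (T : nat -> set R) (d : nat -> \bar R) (delta : R) :
  a <= b -> `[a, b] `<=` \bigcup_i T i ->
  (forall i, (0 <= d i <= delta%:E)%E) ->
  (forall i s t, T i s -> T i t -> (`|s - t|%:E <= d i)%E) ->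
  ((b - a)%:E <= \sum_(0 <= i <oo) (if `[< T i !=set0 >] then d i else 0))%E.
Proof.
move=> ab cov dd Td.
have dfin i : d i = (fine (d i))%:E.
  rewrite fineK// ge0_fin_numE; last by have /andP[] := dd i.
  by have /andP[_ /le_lt_trans] := dd i; apply; exact: ltry.
pose V i := if `[< T i !=set0 >] then `[inf (T i), sup (T i)]%classic else set0.
have HT i : T i !=set0 -> has_sup (T i) /\ has_inf (T i).
  move=> [t Tt]; split; split; try by exists t.
  - exists (t + fine (d i)) => s Ts; have := Td _ _ _ Ts Tt.
    by rewrite dfin lee_fin ler_norml => /andP[_]; rewrite lerBlDl.
  - exists (t - fine (d i)) => s Ts; have := Td _ _ _ Ts Tt.
    by rewrite dfin lee_fin ler_norml => /andP[+ _]; rewrite lerBrDl addrC.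
have mV i : measurable (V i).
  by rewrite /V; case: ifP => _; [exact: measurable_itv|exact: measurable0].
have TV i : T i `<=` V i.
  move=> t Tt; have n0 : T i !=set0 by exists t.
  rewrite /V asboolT//= in_itv/=; have [[_ ub] [_ lb]] := HT i n0.
  by rewrite ge_inf//= sup_upper_bound//; split.
have muV i : (mu (V i) <= if `[< T i !=set0 >] then d i else 0)%E.
  rewrite /V; case: asboolP => n0; last by rewrite measure0.
  have [hs hi] := HT i n0.
  rewrite lebesgue_measure_itv/=; case: ifP => _; last by have /andP[] := dd i.
  rewrite dfin -EFinB lee_fin lerBlDr; apply: ge_sup => // t Tt.
  rewrite -lerBlDl; apply: lb_le_inf => // s Ts.
  rewrite lerBlDl -lerBlDr; have := Td _ _ _ Tt Ts; rewrite dfin lee_fin.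
  exact: le_trans (ler_norm _).
have -> : (b - a)%:E = mu `[a, b]%classic.
  rewrite lebesgue_measure_itv/= lte_fin; case: ltgtP ab => // -> _.
  by rewrite subrr.
apply: (@le_trans _ _ (\sum_(0 <= i <oo) mu (V i))%E).
  apply: measure_sigma_subadditive => //.
  by move=> x /cov[i _ Tx]; exists i => //; exact: TV.
by apply: lee_nneseries => i _ //; exact: muV.
Qed.

(** Moving a point of the closed rectangle slightly towards the centre leads into the open one. *)
Lemma rect_boundary (L1 L2 x y : R) : 0 < L1 -> 0 < L2 ->
  0 <= x <= L1 -> 0 <= y <= L2 -> ~ (0 < x < L1 /\ 0 < y < L2) ->
  (closure (rect L1 L2) `\` interior (rect L1 L2)) (x, y).
Proof.
move=> l1 l2 /andP[x0 xL] /andP[y0 yL] N; split; last by move=> /interior_subset.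
move=> B /nbhs_ballP[e /= e0 eB].
pose D := L1 + L2 + 1.
pose t := Num.min (1 / 2) (e / (2 * D)).
have D0 : 0 < D by rewrite /D; lra.
have t0 : 0 < t by rewrite lt_min divr_gt0//= divr_gt0// mulr_gt0.
have t1 : t <= 1 / 2 by rewrite ge_min lexx.
have te : t * D < e.
  apply: (@le_lt_trans _ _ (e / (2 * D) * D)).
    by apply: ler_wpM2r; [exact: ltW|rewrite ge_min lexx orbT].
  have Dn : D != 0 by exact: lt0r_neq0.
  by rewrite (_ : e / (2 * D) * D = e / 2); [lra|field].
exists (x + t * (L1 / 2 - x), y + t * (L2 / 2 - y)); split.
  rewrite /rect/=; split; apply/andP; split; move: D0 te; rewrite /D; nra.
apply: eB; split => /=; rewrite /ball/= opprD addNKr normrN normrM gtr0_norm//.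
  apply: le_lt_trans te; apply: ler_wpM2l; first exact: ltW.
  rewrite /D ler_norml.
  by apply/andP; split; lra.
apply: le_lt_trans te; apply: ler_wpM2l; first exact: ltW.
  rewrite /D ler_norml.
by apply/andP; split; lra.
Qed.

Lemma abs_le_euclid_dist1 z w : `|z.1 - w.1| <= euclid_dist z w.
Proof. by rewrite /euclid_dist -sqrtr_sqr ler_sqrt ?addr_ge0 ?sqr_ge0// lerDl sqr_ge0. Qed.

Lemma abs_le_euclid_dist2 z w : `|z.2 - w.2| <= euclid_dist z w.
Proof. by rewrite /euclid_dist -sqrtr_sqr ler_sqrt ?addr_ge0 ?sqr_ge0// lerDr sqr_ge0. Qed.

(** Fix a cover by sets of diameter at most [delta], and trim every side by [2 delta] at both
    ends. The trimmed sides are more than [delta] apart, so each set of the cover meets at most one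
    of them, and the sum of the diameters is at least the total length
    [2 (L1 + L2) - 16 delta] of the trimmed sides. *)
Lemma perimeter_rect_ge (L1 L2 : R) : 0 < L1 -> 0 < L2 ->
  ((2 * (L1 + L2))%:E <= perimeter (rect L1 L2))%E.
Proof.
move=> l1 l2; apply/lee_subgt0Pr => e e0.
(* [e / 16] pays for the eight trimmed ends; [L / 5] keeps the trimmed sides nonempty and
   opposite sides more than [delta] apart. *)
pose delta := Num.min (e / 16) (Num.min (L1 / 5) (L2 / 5)).
have d0 : 0 < delta by rewrite !lt_min !divr_gt0.
have dB : delta <= e / 16 by rewrite ge_min lexx.
have d1 : delta <= L1 / 5 by rewrite !ge_min lexx orbT.
have d2 : delta <= L2 / 5 by rewrite !ge_min lexx !orbT.
apply: le_trans (_ : hausdorff1_delta delta _ <= _)%E; last first.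
  by apply: ereal_sup_ubound; exists delta.
apply: le_ereal_inf_tmp => _ [U [cov dU] <-].
have diam0 i := euclid_diam_ge0 (U i).
have dd i : (0 <= euclid_diam (U i) <= delta%:E)%E by rewrite diam0 dU.
have close i z w : U i z -> U i w -> `|z.1 - w.1| <= delta /\ `|z.2 - w.2| <= delta.
  move=> Uz Uw; have := le_trans (euclid_dist_le_diam Uz Uw) (dU i); rewrite lee_fin => h.
  split; first exact: le_trans (abs_le_euclid_dist1 z w) h.
  exact: le_trans (abs_le_euclid_dist2 z w) h.
(* [j.1] tells horizontal from vertical sides, [j.2] the side away from the origin. *)
pose len (j : bool * bool) := if j.1 then L1 else L2.
pose pt (j : bool * bool) (t : R) : R * R :=
  if j.1 then (t, if j.2 then L2 else 0) else (if j.2 then L1 else 0, t).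
pose T j i : set R := [set t | 2 * delta <= t <= len j - 2 * delta /\ U i (pt j t)].
pose g j i := if `[< T j i !=set0 >] then euclid_diam (U i) else 0%E.
have g0 j i : (0 <= g j i)%E by rewrite /g; case: ifP.
have side j : ((len j - 4 * delta)%:E <= \sum_(0 <= i <oo) g j i)%E.
  have -> : len j - 4 * delta = (len j - 2 * delta) - 2 * delta by ring.
  apply: (interval_cover_le (delta := delta)) => //.
  - by case: j => -[] [] /=; rewrite /len/=; lra.
  - move=> t /=; rewrite in_itv/= => /[dup] tI /andP[ta tb].
    have [|i _ Ut] := cov (pt j t); last by exists i.
    move: ta tb; rewrite /len /pt; case: j {tI} => -[] [] /= ta tb; apply: rect_boundary => //;
      by [apply/andP; split; lra|move=> [/andP[? ?] /andP[? ?]]; lra].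
  - move=> i x y [_ Ux] [_ Uy]; apply: le_trans (euclid_dist_le_diam Ux Uy).
    rewrite lee_fin /pt; case: (j.1).
    + exact: (abs_le_euclid_dist1 (x, _) (y, _)).
    + exact: (abs_le_euclid_dist2 (_, x) (_, y)).
have apart j j' i : j != j' -> T j i !=set0 -> T j' i !=set0 -> False.
  move=> jj' [x [/andP[xa xb] Ux]] [y [/andP[ya yb] Uy]].
  have [] := close _ _ _ Ux Uy; rewrite !ler_norml => /andP[c1 c2] /andP[c3 c4].
  move: jj' xa xb ya yb c1 c2 c3 c4 {Ux Uy}; rewrite /len /pt.
  by case: j j' => -[] [] [[] []] //= _ *; lra.
apply: (@le_trans _ _ (\sum_(0 <= i <oo) \sum_(j : bool * bool) g j i)%E).
  rewrite nneseries_sum//.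
  apply: le_trans (_ : (\sum_(j : bool * bool) (len j - 4 * delta)%:E <= _)%E); last first.
    exact: lee_sum.
  rewrite sumEFin lee_fin -(pair_bigA _ (fun a b => len (a, b) - 4 * delta)) /=.
  by rewrite !big_bool /len /=; lra.
apply: lee_nneseries => i _; first by move=> _; apply: sume_ge0.
have [[j Tj]|none] := pselect (exists j, T j i !=set0); last first.
  rewrite big1// => j _; rewrite /g asboolF// => Tj.
  by apply: none; exists j.
rewrite (bigD1 j)//= big1 => [|j' jj']; first by rewrite adde0 /g asboolT.
rewrite /g asboolF// => Tj'; exact: apart jj' Tj' Tj.
Qed.

End RectPerimeter.

(** * Bessel eigenfunctions of a disk *)

Section DiskModes.
Variable R : realType.
Implicit Types (z : R * R) (m : nat) (b : bool).

Variables (c : R * R) (r : R).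
Hypothesis r_gt0 : 0 < r.

Let X z := z.1 - c.1.
Let Y z := z.2 - c.2.

Let gX : gradient X (fun=> 1) (fun=> 0).
Proof.
apply: gradient_eq (gradientD (@gradient_fst R) (gradient_cst (- c.1))) _ _ => z;
  exact: addr0.
Qed.

Let gY : gradient Y (fun=> 0) (fun=> 1).
Proof.
apply: gradient_eq (gradientD (@gradient_snd R) (gradient_cst (- c.2))) _ _ => z;
  exact: addr0.
Qed.

Let sX : smooth X.
Proof. by apply: smoothD; [exact: smooth_fst|exact: smooth_cst]. Qed.

Let sY : smooth Y.
Proof. by apply: smoothD; [exact: smooth_snd|exact: smooth_cst]. Qed.

(** The real part ([b = false]) and the imaginary part ([b = true]) of [(X + i Y)^m], that is
    [rho^m cos (m theta)] and [rho^m sin (m theta)]. *)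
Fixpoint harm b m z : R :=
  if m is m'.+1 then
    if b then X z * harm true m' z + Y z * harm false m' z
    else X z * harm false m' z - Y z * harm true m' z
  else (~~ b)%:R.

Lemma smooth_harm b m : smooth (harm b m).
Proof.
elim: m b => [|m IH] b; first exact: smooth_cst.
case: b => /=; apply: smoothD; try exact: smoothM.
by apply: smooth_opp; exact: smoothM.
Qed.

(** The derivatives of [(X + i Y)^m] are [m (X + i Y)^(m-1)] and [i] times it; multiplication by
    [i] exchanges the two parts, with a sign. *)
Lemma gradient_harm b m : gradient (harm b m)
  (fun z => m%:R * harm b m.-1 z)
  (fun z => m%:R * (-1) ^+ (~~ b) * harm (~~ b) m.-1 z).
Proof.
elim: m b => [|m IH] b.
  by apply: gradient_eq (gradient_cst _) _ _ => z; rewrite !mul0r.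
have rec z : m%:R * harm false m z = m%:R * (X z * harm false m.-1 z - Y z * harm true m.-1 z)
  by case: m {IH} => [|m]; rewrite ?mul0r.
have ime z : m%:R * harm true m z = m%:R * (X z * harm true m.-1 z + Y z * harm false m.-1 z)
  by case: m {IH rec} => [|m]; rewrite ?mul0r.
case: b.
- apply: gradient_eq (gradientD (gradientM gX (IH true)) (gradientM gY (IH false))) _ _ => z;
    rewrite /= ?expr0 ?expr1 -[m.+1%:R]natr1.
  + transitivity (harm true m z + m%:R * (X z * harm true m.-1 z + Y z * harm false m.-1 z)).
      by ring.
    by rewrite -ime; ring.
  + transitivity (harm false m z + m%:R * (X z * harm false m.-1 z - Y z * harm true m.-1 z)).
      by ring.
    by rewrite -rec; ring.
- apply: gradient_eq (gradientD (gradientM gX (IH false))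
     (gradient_opp (gradientM gY (IH true)))) _ _ => z;
    rewrite /= ?expr0 ?expr1 -[m.+1%:R]natr1.
  + transitivity (harm false m z + m%:R * (X z * harm false m.-1 z - Y z * harm true m.-1 z)).
      by ring.
    by rewrite -rec; ring.
  + transitivity (- (harm true m z + m%:R * (X z * harm true m.-1 z + Y z * harm false m.-1 z))).
      by ring.
    by rewrite -ime; ring.
Qed.

(** Euler's identity for a homogeneous polynomial of degree [m]. *)
Lemma harm_euler b m z : X z * (m%:R * harm b m.-1 z) +
  Y z * (m%:R * (-1) ^+ (~~ b) * harm (~~ b) m.-1 z) = m%:R * harm b m z.
Proof. by case: m => [|m]; [rewrite !mul0r; ring|case: b => /=; ring]. Qed.

Let q z := X z * X z + Y z * Y z.

Let gq : gradient q (fun z => 2 * X z) (fun z => 2 * Y z).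
Proof.
by apply: gradient_eq (gradientD (gradientM gX gX) (gradientM gY gY)) _ _ => z; ring.
Qed.

Let sq : smooth q.
Proof. by apply: smoothD; exact: smoothM. Qed.

Lemma smooth_bessel m (f : R * R -> R) : smooth f -> smooth (fun z => bessel m (f z)).
Proof.
pose h n (t : R) := (\prod_(i < n) (- (4 * (m + i).+1%:R)^-1)) * bessel (m + n) t.
have dh n t : is_derive (t : R) (1 : R) (h n) (h n.+1 t).
  have := is_derive1M (@is_derive_cst R R R (\prod_(i < n) (- (4 * (m + i).+1%:R)^-1)) t 1)
    (is_derive_bessel (m + n) t).
  by rewrite mul0r add0r /h big_ord_recr/= mulrA addnS.
move=> sf; have := @smooth_comp _ h f 0%N dh sf.
by rewrite /h; under eq_fun do rewrite big_ord0 mul1r addn0.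
Qed.

(** Up to a constant, [J_m (sqrt lam * rho)] times [cos (m theta)] or [sin (m theta)]. *)
Definition disk_mode b m (lam : R) z := bessel m (lam * q z) * harm b m z.

Lemma smooth_disk_mode b m lam : smooth (disk_mode b m lam).
Proof.
apply: smoothM; last exact: smooth_harm.
by apply: smooth_bessel; apply: smoothM => //; exact: smooth_cst.
Qed.

Let kap m (lam : R) := - lam / (2 * m.+1%:R).

Lemma gradient_bessel_q m lam : gradient (fun z => bessel m (lam * q z))
  (fun z => kap m lam * (bessel m.+1 (lam * q z) * X z))
  (fun z => kap m lam * (bessel m.+1 (lam * q z) * Y z)).
Proof.
have m1 : m.+1%:R != 0 :> R by rewrite pnatr_eq0.
apply: gradient_eq (gradient_comp (@is_derive_bessel R m) (gradient_linear lam gq)) _ _ => z;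
  by rewrite /kap; field.
Qed.

Lemma gradient_disk_mode b m lam : gradient (disk_mode b m lam)
  (fun z => kap m lam * (bessel m.+1 (lam * q z) * X z) * harm b m z +
            bessel m (lam * q z) * (m%:R * harm b m.-1 z))
  (fun z => kap m lam * (bessel m.+1 (lam * q z) * Y z) * harm b m z +
            bessel m (lam * q z) * (m%:R * (-1) ^+ (~~ b) * harm (~~ b) m.-1 z)).
Proof. exact: gradientM (gradient_bessel_q m lam) (gradient_harm b m). Qed.

(** The polynomial [harm b m] is harmonic, the mixed terms are given by [harm_euler], and the
    radial terms combine by [bessel_contiguous]. *)
Lemma disk_mode_laplacian b m lam z :
  dx1 (dx1 (disk_mode b m lam)) z + dx2 (dx2 (disk_mode b m lam)) z =
  - lam * disk_mode b m lam z.
Proof.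
have [-> ->] := gradient_dx (gradient_disk_mode b m lam).
have [-> _] := gradient_dx (gradientD
  (gradientM (gradient_linear (kap m lam) (gradientM (gradient_bessel_q m.+1 lam) gX))
    (gradient_harm b m))
  (gradientM (gradient_bessel_q m lam) (gradient_linear m%:R (gradient_harm b m.-1)))).
have [_ ->] := gradient_dx (gradientD
  (gradientM (gradient_linear (kap m lam) (gradientM (gradient_bessel_q m.+1 lam) gY))
    (gradient_harm b m))
  (gradientM (gradient_bessel_q m lam)
    (gradient_linear (m%:R * (-1) ^+ (~~ b)) (gradient_harm (~~ b) m.-1)))).
have eu := harm_euler b m z.
have m1 : m.+1%:R != 0 :> R by rewrite pnatr_eq0.
have m2 : m.+2%:R != 0 :> R by rewrite pnatr_eq0.
rewrite /disk_mode.
have B0 : bessel m (lam * q z) =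
    bessel m.+1 (lam * q z) - lam * q z / (4 * m.+1%:R * m.+2%:R) * bessel m.+2 (lam * q z).
  by rewrite (bessel_contiguous m) addrK.
have harmonic : m%:R * (m.-1%:R * harm b m.-1.-1 z) + m%:R * (-1) ^+ (~~ b) *
    (m.-1%:R * (-1) ^+ (~~ ~~ b) * harm (~~ ~~ b) m.-1.-1 z) = 0.
  by rewrite negbK; case: b {eu} => /=; rewrite ?expr0 ?expr1; ring.
transitivity (harm b m z * (2 * kap m lam * bessel m.+1 (lam * q z) +
   kap m lam * kap m.+1 lam * q z * bessel m.+2 (lam * q z)) +
  2 * kap m lam * bessel m.+1 (lam * q z) * (X z * (m%:R * harm b m.-1 z) +
  Y z * (m%:R * (-1) ^+ (~~ b) * harm (~~ b) m.-1 z)) +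
  bessel m (lam * q z) * (m%:R * (m.-1%:R * harm b m.-1.-1 z) + m%:R * (-1) ^+ (~~ b) *
    (m.-1%:R * (-1) ^+ (~~ ~~ b) * harm (~~ ~~ b) m.-1.-1 z))).
  by rewrite /q; ring.
rewrite eu harmonic mulr0 addr0 B0 /kap -[m.+1%:R]natr1 in m1 *.
move: m1 m2; move: (m.+2%:R : R) (m%:R : R) (bessel _ _) (bessel _ _) (harm _ _ _) => *.
by field; apply/andP.
Qed.

(** The radial derivative of the mode. It vanishes on the circle where [lam * q] is a zero of
    [bessel_neumann m]. *)
Lemma disk_mode_flux b m lam z :
  X z * dx1 (disk_mode b m lam) z + Y z * dx2 (disk_mode b m lam) z =
  harm b m z * bessel_neumann m (lam * q z).
Proof.
have [-> ->] := gradient_dx (gradient_disk_mode b m lam).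
have m1 : m.+1%:R != 0 :> R by rewrite pnatr_eq0.
transitivity (harm b m z * (kap m lam * bessel m.+1 (lam * q z) * q z) +
  bessel m (lam * q z) * (X z * (m%:R * harm b m.-1 z) +
  Y z * (m%:R * (-1) ^+ (~~ b) * harm (~~ b) m.-1 z))).
  by rewrite /q; ring.
by rewrite harm_euler /bessel_neumann /kap; field.
Qed.

Lemma bessel_neumann_lipschitz m (tau : R) : 0 <= tau -> exists2 C, 0 <= C &
  forall t, 0 <= t <= tau -> `|bessel_neumann m t - bessel_neumann m tau| <= C * (tau - t).
Proof.
move=> tau0.
pose g' (t : R) := m%:R * (- (4 * m.+1%:R)^-1 * bessel m.+1 t) -
  ((2 * m.+1%:R)^-1 * bessel m.+1 t + t / (2 * m.+1%:R) * (- (4 * m.+2%:R)^-1 * bessel m.+2 t)).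
have dg t : is_derive (t : R) (1 : R) (bessel_neumann m) (g' t).
  have d1 := is_derive1M (@is_derive_cst R R R m%:R t 1) (is_derive_bessel m t).
  have d2 : is_derive t (1 : R) (fun t : R => t / (2 * m.+1%:R)) (2 * m.+1%:R)^-1.
    apply: (is_derive_eq (is_derive1M (@is_derive_id R R t 1)
      (@is_derive_cst R R R (2 * m.+1%:R)^-1 t 1))).
    by rewrite mulr0 addr0 mul1r.
  apply: (is_derive_eq (is_deriveB d1 (is_derive1M d2 (is_derive_bessel m.+1 t)))).
  by rewrite mul0r add0r.
have cg : continuous g'.
  have cB n (k : R) : continuous (fun t => k * bessel n t).
    by move=> t; apply: cvgMr; exact: bessel_continuous.
  move=> t; apply: cvgB; first by apply: cvgMr; exact: cB.
  apply: cvgD; first exact: cB.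
  by apply: cvgM; [apply: cvgMl; exact: cvg_id|exact: cB].
have /compact_bounded[C [_ /(_ (`|C| + 1))]] :=
  @continuous_compact _ _ g' _ (continuous_subspaceT cg) (@segment_compact R 0 tau).
rewrite (le_lt_trans (ler_norm C)) ?ltrDl// => /(_ isT) H.
exists (`|C| + 1); first by rewrite addr_ge0.
move=> t /andP[t0]; rewrite le_eqVlt => /predU1P[->|tt]; first by rewrite !subrr normr0 mulr0.
have [x xI E] := @MVT _ (bessel_neumann m) g' _ _ tt (fun x _ => dg x)
  (continuous_subspaceT (@bessel_neumann_continuous R m)).
rewrite distrC E normrM (gtr0_norm (_ : 0 < tau - t)) ?subr_gt0//.
rewrite ler_wpM2r ?subr_ge0 ?(ltW tt)//; apply: H; exists x => //=.
by move: xI; rewrite !in_itv/= => /andP[a d]; rewrite (ltW (le_lt_trans t0 a)) ltW.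
Qed.

(** [disk_rho] is proportional to [tau - lam * q], so the Lipschitz bound for
    [bessel_neumann m] at its zero [tau] is the first-order tangency at the boundary that
    [neumann_eigenfunction] asks for. *)
Lemma disk_mode_eigen b m (tau : R) : 0 <= tau -> bessel_neumann m tau = 0 ->
  neumann_eigenspace (disk c r) (tau / r ^+ 2) (disk_mode b m (tau / r ^+ 2)).
Proof.
move=> tau0 g0; move lamE : (tau / r ^+ 2) => lam.
have r2 : 0 < r ^+ 2 by exact: exprn_gt0.
have rhoE z : disk_rho c r z = r ^+ 2 - q z by rewrite /disk_rho /q !expr2.
have grho : gradient (disk_rho c r) (fun z => - (2 * X z)) (fun z => - (2 * Y z)).
  rewrite (_ : disk_rho c r = (fun z => r ^+ 2 + - q z)); last by apply/funext.
  apply: gradient_eq (gradientD (gradient_cst _) (gradient_opp gq)) _ _ => z;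
  by rewrite add0r.
have bdisk : bounded_set (disk c r).
  exists (`|c.1| + `|c.2| + r); split; first exact: num_real.
  move=> M MM z /= zD; rewrite prod_normE ge_max.
  have a1 : `|c.1 - z.1| <= r by apply: le_trans (ltW zD); exact: abs_le_euclid_dist1.
  have a2 : `|c.2 - z.2| <= r by apply: le_trans (ltW zD); exact: abs_le_euclid_dist2.
  have t1 : `|z.1| <= `|c.1| + r.
    rewrite -[z.1](subKr c.1); apply: le_trans (ler_normB _ _) _.
    by rewrite lerD2l.
  have t2 : `|z.2| <= `|c.2| + r.
    rewrite -[z.2](subKr c.2); apply: le_trans (ler_normB _ _) _.
    by rewrite lerD2l.
  have := normr_ge0 c.1; have := normr_ge0 c.2.
  by move=> *; apply/andP; split; lra.
have [M M0 DM] := bounded_subset_square bdisk.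
have [K K0 HK] := continuous_square_bounded M (smooth_continuous (smooth_harm b m)).
have [C C0 HC] := bessel_neumann_lipschitz m tau0.
have lamr : lam * r ^+ 2 = tau by rewrite -lamE divfK// lt0r_neq0.
have lam0 : 0 <= lam by rewrite -lamE divr_ge0// ltW.
have N z : disk c r z -> `|dx1 (disk_rho c r) z * dx1 (disk_mode b m lam) z +
    dx2 (disk_rho c r) z * dx2 (disk_mode b m lam) z| <= 2 * K * C * lam * disk_rho c r z.
  move=> Dz; have [-> ->] := gradient_dx grho.
  have -> : - (2 * X z) * dx1 (disk_mode b m lam) z + - (2 * Y z) * dx2 (disk_mode b m lam) z =
      - 2 * (X z * dx1 (disk_mode b m lam) z + Y z * dx2 (disk_mode b m lam) z) by ring.
  have norm2 (a : R) : `|- 2 * a| = 2 * `|a| by rewrite normrM normrN normr_nat.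
  rewrite disk_mode_flux norm2 normrM -!mulrA ler_wpM2l//.
  apply: ler_pM => //; first exact: HK (DM _ Dz).
  have := HC (lam * q z); rewrite g0 subr0 -lamr -mulrBr -rhoE; apply.
  have q0 : 0 <= q z by rewrite addr_ge0// -expr2 sqr_ge0.
  rewrite mulr_ge0//= ler_wpM2l//.
  by move: Dz; rewrite (diskE _ r_gt0) /= rhoE subr_gt0 => /ltW.
(* The boundary has no corners: the same defining function is used twice. *)
have dE : disk c r = [set z | 0 < disk_rho c r z /\ 0 < disk_rho c r z].
  by rewrite (diskE _ r_gt0); apply/seteqP; split=> z //= [].
have srho := smooth_disk_rho c r.
have L z : disk c r z -> dx1 (dx1 (disk_mode b m lam)) z + dx2 (dx2 (disk_mode b m lam)) z =
    - lam * disk_mode b m lam z by move=> _; exact: disk_mode_laplacian.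
exact: (neumann_eigenfunction bdisk srho srho (smooth_disk_mode b m lam) dE L N N).
Qed.

End DiskModes.

(** * Linear independence of the Bessel eigenfunctions *)

Section Independence.
Variable R : realType.
Implicit Types (z : R * R) (m n : nat) (b : bool).

Local Notation mu := (@lebesgue_measure R).
Local Notation mu2 := (lebesgue2 R).

Lemma ae_zero_continuous (Omega : set (R * R)) (w : R * R -> R) :
  open Omega -> continuous w -> {ae mu2, forall z, Omega z -> w z = 0} ->
  forall z, Omega z -> w z = 0.
Proof.
move=> oO cw [N [mN N0 sub]] [x y] Oz; apply/eqP/negP => /negP wz.
have : \forall p \near (x, y), Omega p /\ w p != 0.
  apply: filterS2 (open_nbhs_nbhs (conj oO Oz)) _ => [p Op wp|].
    by split; [exact: Op|exact: wp].
  exact: (cvgr_neq0 _ (cw (x, y)) wz).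
move=> /nbhs_ballP[e /= e0 eB].
pose B : set (plane R) := `]x - e, x + e[%classic `*` `]y - e, y + e[%classic.
have BN : B `<=` N.
  move=> [s t] [/= sI tI]; apply: sub => H; have [Op /eqP wp] : Omega (s, t) /\ w (s, t) != 0.
    apply: eB; split => /=; rewrite /ball/=.
      by move: sI; rewrite in_itv/= -ltr_distlC.
    by move: tI; rewrite in_itv/= -ltr_distlC.
  by apply: wp; exact: H.
have mB : measurable B by apply: measurableX; exact: measurable_itv.
have : (mu2 B <= mu2 N)%E by apply: le_measure => //; rewrite inE.
rewrite N0 lebesgue2X; try exact: measurable_itv.
have xe : x - e < x + e by lra.
have ye : y - e < y + e by lra.
rewrite !lebesgue_measure_itv/= !lte_fin xe ye -!EFinB -EFinM lee_fin leNgt.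
by rewrite mulr_gt0// subr_gt0.
Qed.

Variable c : R * R.

Definition angular b m (t : R) : R := if b then sin (m%:R * t) else cos (m%:R * t).

Lemma harm_polar b m (s t : R) :
  harm c b m (circle_pt c s t) = s ^+ m * angular b m t.
Proof.
elim: m b => [|m IH] b.
  by rewrite /angular mul0r sin0 cos0 expr0 mul1r; case: b.
have E : m.+1%:R * t = t + m%:R * t by rewrite -nat1r mulrDl mul1r.
case: b; rewrite /angular E ?sinD ?cosD /= !IH /angular /circle_pt/=
  !(addrC (_ + _) (- _)) !addKr exprS; ring.
Qed.

Lemma disk_mode_polar b m lam (s t : R) :
  disk_mode c b m lam (circle_pt c s t) =
  bessel m (lam * s ^+ 2) * (s ^+ m * angular b m t).
Proof.
rewrite /disk_mode harm_polar; congr (bessel m (lam * _) * _).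
rewrite /circle_pt/= !(addrC (_ + _) (- _)) !addKr -!expr2 !exprMn -mulrDr.
by rewrite cos2Dsin2 mulr1.
Qed.

(** By induction on the degree [N]. Once the coefficients of lower degree are known to vanish,
    dividing by [s^N] and letting [s] tend to [0] leaves only the modes of degree [N], at most one
    cosine and one sine, whatever their [lam i]. An angle where the other one vanishes isolates a
    coefficient. *)
Lemma disk_modes_free (r : R) n (b : 'I_n -> bool) (m : 'I_n -> nat)
    (lam d : 'I_n -> R) : 0 < r ->
  injective (fun i => (m i, b i)) -> (forall i, m i = 0%N -> ~~ b i) ->
  (forall z, disk c r z -> \sum_i d i * disk_mode c (b i) (m i) (lam i) z = 0) ->
  forall i, d i = 0.
Proof.
move=> r0 inj b0 H.
suff Hm N i : (m i < N)%N -> d i = 0 by move=> i; exact: (Hm (m i).+1).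
elim: N i => // N IH i0; rewrite ltnS leq_eqVlt => /predU1P[mN|]; last exact: IH.
pose F (t s : R) := \sum_i
  d i * (bessel (m i) (lam i * s ^+ 2) * (s ^+ (m i - N) * angular (b i) (m i) t)).
have F0 t s : 0 < s < r -> F t s = 0.
  move=> /andP[s0 sr]; have sN : s ^+ N != 0 by rewrite expf_neq0// lt0r_neq0.
  apply: (mulfI sN); rewrite mulr0 -[RHS](H (circle_pt c s t)); last first.
    rewrite /disk/= /euclid_dist /circle_pt/= !opprD !addNKr !sqrrN !exprMn -mulrDr.
    by rewrite cos2Dsin2 mulr1 sqrtr_sqr ger0_norm// ltW.
  rewrite mulr_sumr; apply: eq_bigr => i _; rewrite disk_mode_polar.
  have [iN|Ni] := ltnP (m i) N; first by rewrite IH// !mul0r mulr0.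
  have -> : s ^+ m i = s ^+ (m i - N) * s ^+ N by rewrite -exprD subnK.
  by ring.
have cF t : continuous (F t).
  have cX k : continuous (fun s : R => s ^+ k) by exact: exprn_continuous.
  apply: continuous_big => [|i _ s]; first by move=> x; exact: add_continuous.
  apply: cvgMr; apply: cvgM; last by apply: cvgMl; exact: cX.
  apply: (@continuous_comp _ _ _ (fun s : R => lam i * s ^+ 2) (bessel (m i))).
    by apply: cvgMr; exact: cX.
  exact: bessel_continuous.
have F00 t : F t 0 = 0.
  apply/eqP/negP => /negP Ft.
  have : \forall s \near (0 : R), F t s != 0.
    exact: (cvgr_neq0 _ (cF t 0) Ft).
  move=> /nbhs_ballP[e /= e0 /(_ (Num.min (e / 2) (r / 2)))].
  have s0 : 0 < Num.min (e / 2) (r / 2) by rewrite lt_min !divr_gt0.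
  rewrite /ball/= sub0r normrN gtr0_norm// gt_min.
  have -> : e / 2 < e by lra.
  move=> /(_ isT); rewrite F0 ?eqxx// s0 gt_min.
  by have -> : r / 2 < r by [lra]; rewrite orbT.
pose t0 : R := if b i0 then pi / 2 / N%:R else 0.
have := F00 t0; rewrite /F (bigD1 i0)//= big1 => [|i ii0].
  rewrite addr0 mN subnn expr0 expr2 mul0r mulr0 bessel_at0 !mul1r.
  suff -> : angular (b i0) N t0 = 1 by rewrite mulr1.
  rewrite /angular /t0; case: (boolP (b i0)) => bi; last by rewrite mulr0 cos0.
  have N0 : N%:R != 0 :> R.
    by rewrite pnatr_eq0; apply: contraL bi => /eqP N0; apply: b0; rewrite mN.
  by rewrite mulrC divfK// sin_pihalf.
have [iN|Ni|iN] := ltngtP (m i) N.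
- by rewrite IH// mul0r.
- by rewrite (expr0n _ (m i - N)) subn_eq0 leqNgt Ni /= mul0r !mulr0.
rewrite iN subnn; have bi : b i = ~~ b i0.
  have [bE|] := eqVneq (b i) (b i0); last by case: (b i) (b i0) => -[].
  by move: ii0; rewrite (inj i i0 _) ?eqxx//= iN mN bE.
suff -> : angular (b i) N t0 = 0 by rewrite !mulr0.
rewrite bi /angular /t0; case: (boolP (b i0)) => bi0 /=; last by rewrite mulr0 sin0.
have N0 : N%:R != 0 :> R.
  by rewrite pnatr_eq0; apply: contraL bi0 => /eqP N0; apply: b0; rewrite mN.
by rewrite mulrC divfK// cos_pihalf.
Qed.

End Independence.

(** * Upper bound for the eigenvalues of a disk *)

Section DiskEigenvalue.
Variable R : realType.
Local Notation mu2 := (lebesgue2 R).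
Variables (c : R * R) (r : R).
Hypothesis r_gt0 : 0 < r.

(** The index [0] stands for the constant, and the indices [2 m - 1] and [2 m] for the two modes of
    degree [m]. For indices up to [k] the degree satisfies [2 m <= k + 1], and then
    [2 m (m + 1) <= (k + 1)^2]. *)
Lemma disk_eigenvalue_lt (k : nat) : (0 < k)%N -> exists2 t : R,
  0 <= t < k.+1%:R ^+ 2 / r ^+ 2 & (neumann_eigenvalue (disk c r) k <= t%:E)%E.
Proof.
move=> k0.
have kk0 : 0 < k.+1%:R ^+ 2 :> R by rewrite exprn_gt0// ltr0n.
have /choice[tau tauP] : forall m, exists t : R, [/\ 0 <= t, bessel_neumann m t = 0 &
    (2 * m <= k.+1)%N -> t < k.+1%:R ^+ 2].
  case=> [|m]; first by exists 0; split => //; rewrite /bessel_neumann !mul0r subr0.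
  have [t /andP[t0 tm] gt] := bessel_neumann_zero R (ltn0Sn m).
  exists t; split => // [|mk]; first exact: ltW.
  apply: (lt_le_trans tm); rewrite -!natrM -natrX ler_nat -mulnn.
  by apply: leq_mul => //; lia.
pose m (i : nat) := uphalf i; pose b (i : nat) := ~~ odd i && (0 < i)%N.
have mb_inj i j : (m i, b i) = (m j, b j) -> i = j.
  rewrite /m /b !uphalf_half => -[].
  have := odd_double_half i; have := odd_double_half j.
  by case: (odd i); case: (odd j); rewrite /=; case: i => [|i]; case: j => [|j] //=; lia.
pose l (i : 'I_k.+1) : R := tau (m i) / r ^+ 2.
have r2 : 0 < r ^+ 2 by rewrite exprn_gt0.
pose t := \big[Num.max/0]_i l i.
exists t.
  rewrite /t bigmax_ge_id/=; apply: bigmax_lt => [|i _]; first by rewrite divr_gt0.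
  rewrite /l ltr_pM2r ?invr_gt0//; have [_ _ ->//] := tauP (m i).
  by have := odd_double_half i; rewrite /m uphalf_half; have := ltn_ord i; case: (odd i) => /=; lia.
apply: ge_ereal_inf; exists t%:E => //; exists t => //; exists l; split.
  by move=> i; exact: le_bigmax.
move=> lam.
pose A := [pred i | l i == lam].
exists (fun j : 'I_#|A| => disk_mode c (b (enum_val j)) (m (enum_val j)) (l (enum_val j))); split.
  move=> j; have /eqP <- : l (enum_val j) == lam by have := enum_valP j; rewrite inE.
  by have [t0 g0 _] := tauP (m (enum_val j)); exact: disk_mode_eigen.
move=> d d0; apply: (@disk_modes_free R c r #|A| (fun j => b (enum_val j)) (fun j => m (enum_val j))
  (fun j => l (enum_val j)) d r_gt0).
- by move=> i j /mb_inj/val_inj/enum_val_inj.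
- by move=> j; rewrite /m /b; case: (nat_of_ord (enum_val j)).
- apply: (ae_zero_continuous _ _ d0); first exact: open_disk.
  apply: continuous_big => [|j _ z]; first by move=> x; exact: add_continuous.
  by apply: cvgMr; exact: (smooth_continuous (smooth_disk_mode _ _ _ _)).
Qed.

End DiskEigenvalue.

(** * Comparison of the rectangle with the disk *)

Section Comparison.
Variable R : realType.

Lemma rect_admissible (L1 L2 : R) : 0 < L1 -> 0 < L2 -> admissible (rect L1 L2).
Proof.
move=> l1 l2; split.
- by exists (L1 / 2, L2 / 2); split => /=; apply/andP; split; lra.
- exact: rect_bounded.
- exact: open_rect.
- move=> x y t; rewrite !inE => -[/andP[a1 a2] /andP[a3 a4]] [/andP[b1 b2] /andP[b3 b4]].
  have conv (L u v : R) : 0 < u -> u < L -> 0 < v -> v < L ->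
      0 < t%:num * u + (1 - t%:num) * v < L.
    move=> u0 uL v0 vL; have t0 : 0 <= t%:num by [].
    have t1 : t%:num <= 1 by [].
    have t2 : 0 <= 1 - t%:num by rewrite subr_ge0.
    have wm : 0 < Num.min (Num.min u v) (Num.min (L - u) (L - v)).
      by rewrite !lt_min u0 v0 !subr_gt0 uL.
    move: wm; set w := Num.min _ _ => wm.
    have [wu [wv [wu' wv']]] : w <= u /\ w <= v /\ w <= L - u /\ w <= L - v.
      by rewrite /w !ge_min !lexx ?orbT.
    move: (t%:num : R) t0 t2 => s s0 s1.
    have h1 := mulr_ge0 s0 (_ : 0 <= u - w); have h2 := mulr_ge0 s1 (_ : 0 <= v - w).
    have h3 := mulr_ge0 s0 (_ : 0 <= L - u - w); have h4 := mulr_ge0 s1 (_ : 0 <= L - v - w).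
    move: h1 h2 h3 h4; rewrite !subr_ge0 => /(_ wu) h1 /(_ wv) h2 /(_ wu') h3 /(_ wv') h4.
    by apply/andP; split; lra.
  by split; exact: conv.
Qed.

Lemma objective_rect_ge (k : nat) : (0 < k)%N ->
  ((4 * pi ^+ 2 * k.+1%:R ^+ 2)%:E <= objective k (rect 1 k%:R^-1 : set (R * R)))%E.
Proof.
move=> k0; have kR : 0 < k%:R :> R by rewrite ltr0n.
have h0 : 0 < k%:R^-1 :> R by rewrite invr_gt0.
have P := perimeter_rect_ge ltr01 h0.
have E := @rect_eigenvalue_ge R k k0.
rewrite /objective expe2.
have p0 : 0 <= 2 * (1 + k%:R^-1) :> R by rewrite mulr_ge0// addr_ge0// ltW.
have -> : 4 * pi ^+ 2 * k.+1%:R ^+ 2 =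
    2 * (1 + k%:R^-1) * (2 * (1 + k%:R^-1)) * (k%:R * pi) ^+ 2 :> R.
  by rewrite -nat1r; field; exact: lt0r_neq0.
rewrite EFinM; apply: lee_pmul => //.
- by rewrite lee_fin sqr_ge0.
- by rewrite EFinM; apply: lee_pmul.
Qed.

Lemma objective_disk_lt (c : R * R) (r : R) (k : nat) : 0 < r -> (0 < k)%N ->
  (objective k (disk c r) < (4 * pi ^+ 2 * k.+1%:R ^+ 2)%:E)%E.
Proof.
move=> r0 k0; have [t /andP[t0 tk] mu_t] := disk_eigenvalue_lt c r0 k0.
have P := perimeter_disk_le c r0.
have P0 : (0 <= perimeter (disk c r))%E.
  apply: le_ereal_sup_tmp; exists (hausdorff1_delta 1 (closure (disk c r) `\` interior (disk c r))).
    by exists 1 => //; exact: ltr01.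
  apply: le_ereal_inf_tmp => _ [U _ <-]; apply: nneseries_ge0 => i _ _.
  exact: euclid_diam_ge0.
rewrite /objective expe2.
apply: (@le_lt_trans _ _ ((2 * pi * r)%:E * (2 * pi * r)%:E * t%:E)%E).
  apply: (@le_trans _ _ (perimeter (disk c r) * perimeter (disk c r) * t%:E)%E).
    by apply: lee_wpmul2l => //; exact: mule_ge0.
  by apply: lee_wpmul2r; [rewrite lee_fin|exact: lee_pmul].
rewrite -!EFinM lte_fin.
have -> : 4 * pi ^+ 2 * k.+1%:R ^+ 2 = 2 * pi * r * (2 * pi * r) * (k.+1%:R ^+ 2 / r ^+ 2) :> R.
  by field; exact: lt0r_neq0.
by rewrite ltr_pM2l// !mulr_gt0// pi_gt0.
Qed.

End Comparison.

Theorem theorem3p5 (R : realType) (c : R * R) (r : R) (k : nat)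
    (r_gt0 : 0 < r) (k_ge1 : (1 <= k)%N) :
  (objective k (disk c r) <
   ereal_sup [set objective k Omega | Omega in @admissible R])%E.
Proof.
apply: lt_le_trans (objective_disk_lt c r_gt0 k_ge1) _.
apply: le_trans (objective_rect_ge R k_ge1) _.
apply: ereal_sup_ubound; exists (rect 1 k%:R^-1) => //.
by apply: rect_admissible; rewrite ?invr_gt0 ?ltr0n.
Qed.
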